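(* Let $\boldsymbol{\mathcal A},\boldsymbol{\mathcal B}$ be $^*$-algebra deformations of $^*$-algebras $\mathcal A,\mathcal B$ over $\mathsf C$ and let $\boldsymbol{\mathfrak X}$ be a $(\boldsymbol{\mathcal B}$-$\boldsymbol{\mathcal A})$-bimodule with $\boldsymbol{\mathcal A}$-valued inner product satisfying X1--X5 and P. Assume furthermore that the classical limit $\mathfrak X=\mathfrak C\boldsymbol{\mathfrak X}$ also satisfies X4 and P. Then the functors $\mathfrak C\circ\mathfrak R_{\boldsymbol{\mathfrak X}}$ and $\mathfrak R_{\mathfrak X}\circ\mathfrak C$ from ${}^*\text{-}\mathsf{rep}(\boldsymbol{\mathcal A})$ to ${}^*\text{-}\mathsf{rep}(\mathcal B)$ are naturally isomorphic: for a $^*$-representation $(\boldsymbol{\mathfrak H},\boldsymbol\pi)$ of $\boldsymbol{\mathcal A}$ the map $U:\mathfrak C\mathfrak R_{\boldsymbol{\mathfrak X}}(\boldsymbol{\mathfrak H})\to\mathfrak R_{\mathfrak X}\mathfrak C(\boldsymbol{\mathfrak H})$ defined for $\boldsymbol x\in\boldsymbol{\mathfrak X}$ and $\phi\in\boldsymbol{\mathfrak H}$ by $$U\big(\mathfrak C([\boldsymbol x\otimes\phi])\big)=[\mathfrak C\boldsymbol x\otimes\mathfrak C\phi]$$ is a (well-defined) unitary intertwiner between $\mathfrak C\mathfrak R_{\boldsymbol{\mathfrak X}}(\boldsymbol\pi)$ and $\mathfrak R_{\mathfrak X}\mathfrak C(\boldsymbol\pi)$.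
   Context: $\mathsf R$ is an ordered ring (commutative ring with $1\ne0$ and a subset $\mathsf P$ closed under sums and products such that $\mathsf R$ is the disjoint union $-\mathsf P\cup\{0\}\cup\mathsf P$), and $\mathsf C=\mathsf R(\mathrm i)$ with $\mathrm i^2=-1$ and the usual conjugation. $\mathsf R[[\lambda]]$ is an ordered ring: a non-zero $a=\sum_{r\ge r_0}\lambda^ra_r$ with $a_{r_0}\ne0$ is positive iff $a_{r_0}>0$; $\mathsf C[[\lambda]]=\mathsf R[[\lambda]](\mathrm i)$. $\mathfrak C$ applied to a formal power series is its zeroth order term. A $^*$-algebra over $\mathsf C$ is an associative (not necessarily unital) $\mathsf C$-algebra with an antilinear involution satisfying $(AB)^*=B^*A^*$. A $^*$-algebra deformation of $\mathcal A$ is $\boldsymbol{\mathcal A}=\mathcal A[[\lambda]]$ with a $\mathsf C[[\lambda]]$-bilinear associative product $\mu=\sum_r\lambda^r\mu_r$ and a $^*$-involution $I=\sum_r\lambda^rI_r$ for $\mu$ such that $\mu_0,I_0$ are the given product and involution of $\mathcal A$. A linear functional $\omega$ is positive if $\omega(A^*A)\ge0$ for all $A$; a Hermitian $A$ satisfies $A\ge0$ if $\omega(A)\ge0$ for all positive linear functionals. A pre-Hilbert space over $\mathsf C$ (or $\mathsf C[[\lambda]]$) is a module with a Hermitian inner product (linear in the second argument), $\langle\phi,\phi\rangle\ge0$, and $\langle\phi,\phi\rangle=0\Rightarrow\phi=0$. ${}^*\text{-}\mathsf{rep}(\mathcal A)$ is the category of $^*$-representations of $\mathcal A$ by adjointable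 operators on pre-Hilbert spaces over the respective ring with isometric (alternatively: adjointable, or unitary) intertwiners as morphisms (same choice throughout). The following axioms are used over $\mathsf C$ for $(\mathcal A,\mathcal B)$ and over $\mathsf C[[\lambda]]$ for $(\boldsymbol{\mathcal A},\boldsymbol{\mathcal B})$: X1) $\langle\cdot,\cdot\rangle_{\mathcal A}:\mathfrak X\times\mathfrak X\to\mathcal A$ is linear in the second argument; X2) $\langle x,y\rangle_{\mathcal A}=\langle y,x\rangle_{\mathcal A}^*$; X3) $\langle x,y\cdot A\rangle_{\mathcal A}=\langle x,y\rangle_{\mathcal A}A$; X4) $\langle x,x\rangle_{\mathcal A}\ge0$; X5) $\langle x,B\cdot y\rangle_{\mathcal A}=\langle B^*\cdot x,y\rangle_{\mathcal A}$; P) for every $^*$-representation $(\mathfrak H,\pi)$ of $\mathcal A$ the form $\langle x\otimes\psi,y\otimes\phi\rangle=\langle\psi,\pi(\langle x,y\rangle_{\mathcal A})\phi\rangle$ on $\mathfrak X\otimes_{\mathcal A}\mathfrak H$ is positive semi-definite. Rieffel induction $\mathfrak R_{\mathfrak X}$ sends $(\mathfrak H,\pi)$ to $\mathfrak K=\widetilde{\mathfrak K}/\widetilde{\mathfrak K}^\perp$, $\widetilde{\mathfrak K}=\mathfrak X\otimes_{\mathcal A}\mathfrak H$ with the form above, with $\mathcal B$ acting by $B[x\otimes\psi]=[B\cdot x\otimes\psi]$, and an intertwiner $T$ to $[x\otimes\psi]\mapsto[x\otimes T\psi]$; analogously $\mathfrak R_{\boldsymbol{\mathfrak X}}$ over $\mathsf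 C[[\lambda]]$. Classical limits: for a pre-Hilbert space $\boldsymbol{\mathfrak H}$ over $\mathsf C[[\lambda]]$, $\mathfrak C\boldsymbol{\mathfrak H}=\boldsymbol{\mathfrak H}/\{\phi\mid\mathfrak C\langle\phi,\psi\rangle=0\ \forall\psi\}$, with class map $\phi\mapsto\mathfrak C\phi$ and $\langle\mathfrak C\phi,\mathfrak C\psi\rangle=\mathfrak C\langle\phi,\psi\rangle$, a pre-Hilbert space over $\mathsf C$; a representation $\boldsymbol\pi$ goes to $(\mathfrak C\boldsymbol\pi)(\mathfrak CA)\mathfrak C\phi=\mathfrak C(\boldsymbol\pi(A)\phi)$ and an intertwiner $\boldsymbol T$ to $\mathfrak C\phi\mapsto\mathfrak C(\boldsymbol T\phi)$. For the bimodule, $\mathfrak C\boldsymbol{\mathfrak X}=\boldsymbol{\mathfrak X}/\{\boldsymbol x\mid\mathfrak C\langle\boldsymbol x,\boldsymbol y\rangle_{\boldsymbol{\mathcal A}}=0\ \forall\boldsymbol y\}$ with class map $\boldsymbol x\mapsto\mathfrak C\boldsymbol x$, is a $(\mathcal B$-$\mathcal A)$-bimodule via $B\cdot\mathfrak C\boldsymbol x=\mathfrak C(B\cdot\boldsymbol x)$, $\mathfrak C\boldsymbol x\cdot A=\mathfrak C(\boldsymbol x\cdot A)$, with $\langle\mathfrak C\boldsymbol x,\mathfrak C\boldsymbol y\rangle_{\mathcal A}=\mathfrak C\langle\boldsymbol x,\boldsymbol y\rangle_{\boldsymbol{\mathcal A}}$ (it satisfies X1, X2, X3, X5). *)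

(* Defs.v *)
From HB Require Import structures.
From mathcomp Require Import all_boot all_order all_algebra.
From mathcomp Require Import boolp.
From mathcomp Require Import freeg.
From mathcomp Require Import ring.

Set Implicit Arguments.
Unset Strict Implicit.
Unset Printing Implicit Defensive.

Import Order.TTheory GRing.Theory Num.Theory.
Local Open Scope ring_scope.

(* V[[lambda]] *)
Record series (V : Type) := Series { scoef : nat -> V }.

HB.instance Definition _ (V : Type) := gen_eqMixin (series V).
HB.instance Definition _ (V : Type) := gen_choiceMixin (series V).

Lemma seriesP (V : Type) (a b : series V) : (forall n, scoef a n = scoef b n) -> a = b.
Proof. by case: a b => [a] [b] /= h; congr Series; apply/funext. Qed.

Section SeriesZmodule.
Variable V : zmodType.
Implicit Types a b : series V.

Definition ser_zero : series V := Series (fun=> 0).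
Definition ser_opp a : series V := Series (fun n => - scoef a n).
Definition ser_add a b : series V := Series (fun n => scoef a n + scoef b n).

Lemma ser_addA : associative ser_add.
Proof. by move=> a b c; apply/seriesP => n /=; rewrite addrA. Qed.
Lemma ser_addC : commutative ser_add.
Proof. by move=> a b; apply/seriesP => n /=; rewrite addrC. Qed.
Lemma ser_add0 : left_id ser_zero ser_add.
Proof. by move=> a; apply/seriesP => n /=; rewrite add0r. Qed.
Lemma ser_addN : left_inverse ser_zero ser_opp ser_add.
Proof. by move=> a; apply/seriesP => n /=; rewrite addNr. Qed.

HB.instance Definition _ := GRing.isZmodule.Build (series V)
  ser_addA ser_addC ser_add0 ser_addN.

Lemma scoef0 n : scoef (0 : series V) n = 0. Proof. by []. Qed.
Lemma scoefD a b n : scoef (a + b) n = scoef a n + scoef b n. Proof. by []. Qed.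
Lemma scoefN a n : scoef (- a) n = - scoef a n. Proof. by []. Qed.
Lemma scoefB a b n : scoef (a - b) n = scoef a n - scoef b n. Proof. by []. Qed.

Definition ser_const (v : V) : series V := Series (fun n => if n is 0%N then v else 0).

Lemma ser_constD u v : ser_const (u + v) = ser_const u + ser_const v.
Proof. by apply/seriesP => -[|n] //=; rewrite addr0. Qed.
End SeriesZmodule.

Lemma sum_triangle (V : nmodType) (n : nat) (f : nat -> nat -> nat -> V) :
  \sum_(i < n.+1) \sum_(k < i.+1) f k (i - k)%N (n - i)%N =
  \sum_(k < n.+1) \sum_(l < (n - k).+1) f k l (n - k - l)%N.
Proof.
transitivity (\sum_(k < n.+1) \sum_(i < n.+1 | (k <= i)%N) f k (i - k)%N (n - i)%N).
  rewrite (exchange_big_dep predT) //=; apply: eq_bigr => i _.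
  by rewrite (big_ord_widen n.+1 (fun k => f k (i - k)%N (n - i)%N)) // ltnS.
apply: eq_bigr => k _.
rewrite -(big_mkord (fun l => true) (fun l => f k l (n - k - l)%N)) /=.
rewrite -(big_mkord (fun i => (k <= i)%N) (fun i => f k (i - k)%N (n - i)%N)).
rewrite -[X in \sum_(X <= _ < _ | _) _]/(0%N).
rewrite (big_cat_nat (n := k)) //=; last by rewrite ltnW.
rewrite big_nat_cond big1 ?add0r; last first.
  by move=> i /andP[/andP[_ ltik]]; rewrite leqNgt ltik.
rewrite -{1}[k : nat]add0n big_addn subSn -1?ltnS //.
rewrite [LHS]big_mkcond [RHS]big_nat [LHS]big_nat.
by apply: eq_bigr => i _; rewrite leq_addl addnK addnC subnDA.
Qed.

Lemma sum_triangleC (V : nmodType) (n : nat) (f : nat -> nat -> nat -> V) :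
  \sum_(k < n.+1) \sum_(l < (n - k).+1) f k l (n - k - l)%N =
  \sum_(l < n.+1) \sum_(k < (n - l).+1) f k l (n - l - k)%N.
Proof.
rewrite -sum_triangle -(sum_triangle n (fun k l => f l k)); apply: eq_bigr => i _.
rewrite (reindex_inj rev_ord_inj) /=; apply: eq_bigr => j _.
by rewrite subSS subKn // -ltnS.
Qed.

Section SeriesRing.
Variable R : comNzRingType.
Implicit Types a b : series R.

Definition ser_one : series R := ser_const 1.
Definition ser_mulr a b : series R :=
  Series (fun n => \sum_(i < n.+1) scoef a i * scoef b (n - i)%N).

Lemma ser_mulrC : commutative ser_mulr.
Proof.
move=> a b; apply/seriesP => n /=; rewrite (reindex_inj rev_ord_inj) /=.
by apply: eq_bigr => i _; rewrite subSS subKn -1?ltnS // mulrC.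
Qed.
Lemma ser_mulrA : associative ser_mulr.
Proof.
move=> a b c; apply/seriesP => n /=.
transitivity (\sum_(i < n.+1) \sum_(k < i.+1)
   scoef a k * (scoef b (i - k)%N * scoef c (n - i)%N)); last first.
  by apply: eq_bigr => i _; rewrite mulr_suml; apply: eq_bigr => j _; rewrite mulrA.
rewrite (sum_triangle n (fun i j k => scoef a i * (scoef b j * scoef c k))).
by apply: eq_bigr => i _; rewrite mulr_sumr.
Qed.
Lemma ser_mul1r : left_id ser_one ser_mulr.
Proof.
move=> a; apply/seriesP => n /=; rewrite big_ord_recl /= mul1r subn0 big1 ?addr0 //.
by move=> i _; rewrite mul0r.
Qed.
Lemma ser_mulrDl : left_distributive ser_mulr +%R.
Proof.
move=> a b c; apply/seriesP => n /=; rewrite -big_split /=.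
by apply: eq_bigr => i _; rewrite mulrDl.
Qed.
Lemma ser_one_neq0 : ser_one != 0.
Proof. by apply/eqP => /(congr1 (fun a => scoef a 0))/eqP; rewrite /= oner_eq0. Qed.

HB.instance Definition _ := GRing.Zmodule_isComNzRing.Build (series R)
  ser_mulrA ser_mulrC ser_mul1r ser_mulrDl ser_one_neq0.

Lemma scoef_mulr a b n : scoef (a * b) n = \sum_(i < n.+1) scoef a i * scoef b (n - i)%N.
Proof. by []. Qed.
End SeriesRing.

(* An ordered ring has no zero divisors, hence is a [realDomainType]; the
   unit/inverse data this structure carries beyond the order play no role and
   are chosen classically for R[[lambda]]. *)
Section SeriesOrder.
Variable R : realDomainType.
Implicit Types a b : series R.

Definition ser_inv a : series R :=
  if pselect (exists b, b * a = 1) is left e then projT1 (cid e) else a.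
Definition ser_unit a : bool := `[< exists b, b * a = 1 >].

Lemma ser_mulVr : {in ser_unit, left_inverse 1 ser_inv *%R}.
Proof.
move=> a /asboolP e; rewrite /ser_inv.
by case: pselect => // e'; case: (cid e').
Qed.
Lemma ser_unitP a b : b * a = 1 -> ser_unit a.
Proof. by move=> e; apply/asboolP; exists b. Qed.
Lemma ser_inv_out : {in [predC ser_unit], ser_inv =1 id}.
Proof.
move=> a /negP h; rewrite /ser_inv; case: pselect => // e.
by case: h; apply/asboolP.
Qed.
HB.instance Definition _ := GRing.ComNzRing_hasMulInverse.Build (series R)
  ser_mulVr ser_unitP ser_inv_out.

Definition ser_pos a : Prop :=
  exists r, 0 < scoef a r /\ forall k, (k < r)%N -> scoef a k = 0.

Lemma ser_lowest a : a != 0 ->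
  exists r, scoef a r != 0 /\ forall k, (k < r)%N -> scoef a k = 0.
Proof.
move=> a0.
have e : exists n, scoef a n != 0.
  apply: contrapT => h; move/eqP: a0; apply; apply/seriesP => n.
  by apply: contrapT => /eqP h'; apply: h; exists n.
exists (ex_minn e); case: ex_minnP => m am mmin; split=> // k km.
by apply/eqP; apply: contraT => /mmin; rewrite leqNgt km.
Qed.

Lemma scoef_mulr_lowest a b r s :
    (forall k, (k < r)%N -> scoef a k = 0) -> (forall k, (k < s)%N -> scoef b k = 0) ->
  scoef (a * b) (r + s) = scoef a r * scoef b s /\
  forall k, (k < r + s)%N -> scoef (a * b) k = 0.
Proof.
move=> ha hb; split.
  rewrite scoef_mulr (bigD1 (inord r)) //= inordK ?ltnS ?leq_addr // addKn.
  rewrite big1 ?addr0 // => i ir; have [lt_ir|] := ltnP i r; first by rewrite ha ?mul0r.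
  rewrite leq_eqVlt => /orP[/eqP e|lt_ri].
    by case/eqP: ir; apply/val_inj; rewrite /= inordK ?ltnS ?leq_addr.
  rewrite [scoef b _]hb ?mulr0 // ltn_subLR ?ltn_add2r //; last by rewrite -ltnS.
move=> k lt_k; rewrite scoef_mulr big1 // => i _.
have [lt_ir|le_ri] := ltnP i r; first by rewrite ha ?mul0r.
by rewrite [scoef b _]hb ?mulr0 // ltn_subLR -1?ltnS // ltnS (leq_trans lt_k) // leq_add2r.
Qed.

Lemma ser_integral : GRing.integral_domain_axiom (series R).
Proof.
move=> a b ab0; apply: contraT; rewrite negb_or.
case/andP=> /ser_lowest[r [ar ha]] /ser_lowest[s [bs hb]].
have [e _] := scoef_mulr_lowest ha hb.
by move/eqP: e; rewrite ab0 /= eq_sym mulf_eq0 (negPf ar) (negPf bs).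
Qed.
HB.instance Definition _ := GRing.ComUnitRing_isIntegral.Build (series R) ser_integral.

Definition ser_le a b : bool := `[< a = b \/ ser_pos (b - a) >].
Definition ser_lt a b : bool := (b != a) && ser_le a b.
Definition ser_norm a : series R := if ser_le 0 a then a else - a.

Lemma ser_le0P a : ser_le 0 a <-> a = 0 \/ ser_pos a.
Proof.
split=> [/asboolP|h]; first by rewrite subr0 => -[<-|]; [left|right].
by apply/asboolP; rewrite subr0; case: h => [->|]; [left|right].
Qed.

Lemma ser_pos_opp a : a != 0 -> ser_pos a \/ ser_pos (- a).
Proof.
case/ser_lowest=> r [ar ha]; have [ar0|ar0|e] := ltgtP (scoef a r) 0.
- by right; exists r; rewrite scoefN oppr_gt0; split=> // k /ha e; rewrite scoefN e oppr0.
- by left; exists r.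
- by rewrite e eqxx in ar.
Qed.

Lemma ser_pos_asym a : ser_pos a -> ser_pos (- a) -> False.
Proof.
case=> r [ar ha] [s []]; rewrite scoefN oppr_gt0 => as0 hs.
have [rs|sr|e] := ltngtP r s.
- by have /eqP := hs r rs; rewrite scoefN oppr_eq0 (gt_eqF ar).
- by rewrite (ha s sr) ltxx in as0.
- by rewrite -e in as0; have := lt_trans ar as0; rewrite ltxx.
Qed.

Lemma ser_pos_neq0 a : ser_pos a -> a != 0.
Proof. by case=> r [ar _]; apply/eqP => e; rewrite e ltxx in ar. Qed.

Lemma ser_posD a b : ser_pos a -> ser_pos b -> ser_pos (a + b).
Proof.
case=> r [ar ha] [s [bs hb]].
exists (minn r s); split=> [|k]; last first.
  by rewrite leq_min => /andP[kr ks]; rewrite scoefD ha ?hb ?addr0.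
rewrite scoefD; have [rs|sr|e] := ltngtP r s.
- by rewrite hb // addr0.
- by rewrite ha // add0r.
- by rewrite addr_gt0 // e.
Qed.

Lemma ser_posM a b : ser_pos a -> ser_pos b -> ser_pos (a * b).
Proof.
case=> r [ar ha] [s [bs hb]]; have [e h] := scoef_mulr_lowest ha hb.
by exists (r + s)%N; rewrite e mulr_gt0.
Qed.

Lemma ser_le0_add a b : ser_le 0 a -> ser_le 0 b -> ser_le 0 (a + b).
Proof.
move=> /ser_le0P[->|pa]; first by rewrite add0r.
move=> /ser_le0P[->|pb]; first by rewrite addr0; apply/ser_le0P; right.
by apply/ser_le0P; right; apply: ser_posD.
Qed.
Lemma ser_le0_mul a b : ser_le 0 a -> ser_le 0 b -> ser_le 0 (a * b).
Proof.
move=> /ser_le0P[->|pa]; first by rewrite mul0r => _; apply/ser_le0P; left.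
move=> /ser_le0P[->|pb]; first by rewrite mulr0; apply/ser_le0P; left.
by apply/ser_le0P; right; apply: ser_posM.
Qed.
Lemma ser_sub_ge0 a b : ser_le 0 (b - a) = ser_le a b.
Proof.
apply/idP/idP => [/ser_le0P h|/asboolP h].
  by apply/asboolP; case: h => [/eqP|]; [rewrite subr_eq0 => /eqP ->; left|right].
by apply/ser_le0P; case: h => [->|]; [rewrite subrr; left|right].
Qed.
Lemma ser_le0_anti a : ser_le 0 a -> ser_le a 0 -> a = 0.
Proof.
move=> /ser_le0P[->//|pa]; rewrite -ser_sub_ge0 sub0r => /ser_le0P[/eqP|/(ser_pos_asym pa)//].
by rewrite oppr_eq0 => /eqP.
Qed.
Lemma ser_le0_total a : ser_le 0 a || ser_le a 0.
Proof.
rewrite -(ser_sub_ge0 a) sub0r; apply/orP.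
have [->|/ser_pos_opp[p|p]] := eqVneq a 0.
- by left; apply/ser_le0P; left.
- by left; apply/ser_le0P; right.
- by right; apply/ser_le0P; right.
Qed.
Lemma ser_normN a : ser_norm (- a) = ser_norm a.
Proof.
rewrite /ser_norm opprK; have [h|h] := boolP (ser_le 0 a).
  case: ifP => // h'; have e : - a = 0 by apply: ser_le0_anti; rewrite // -ser_sub_ge0 sub0r opprK.
  by rewrite e -[a]opprK e oppr0.
have := ser_le0_total a; rewrite (negPf h) /= -ser_sub_ge0 sub0r => ->.
by [].
Qed.
Lemma ser_ge0_norm a : ser_le 0 a -> ser_norm a = a.
Proof. by rewrite /ser_norm => ->. Qed.

HB.instance Definition _ := Num.IntegralDomain_isLeReal.Build (series R)
  ser_le0_add ser_le0_mul ser_le0_anti ser_sub_ge0 ser_le0_total ser_normN ser_ge0_norm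
  (fun a b => erefl (ser_lt a b)).

Lemma ser_gt0P a : 0 < a <-> ser_pos a.
Proof.
rewrite lt_def; split; first by case/andP=> a0 /ser_le0P[e|//]; rewrite e eqxx in a0.
by move=> pa; rewrite ser_pos_neq0 //; apply/ser_le0P; right.
Qed.

Lemma scoef_ge0 a : 0 <= a -> 0 <= scoef a 0.
Proof.
case/ser_le0P=> [->|[[|r] [ar ha]]]; first exact: lexx; first exact: ltW.
by rewrite ha.
Qed.
End SeriesOrder.

(* R(i); MathComp-real-closed's complex is a ring only over a field *)
Record cplx (R : Type) := Cplx { re : R; im : R }.

Section CplxChoice.
Variable R : choiceType.
Definition cplx_pair (z : cplx R) := (re z, im z).
Definition pair_cplx (p : R * R) := Cplx p.1 p.2.
Lemma cplx_pairK : cancel cplx_pair pair_cplx. Proof. by case. Qed.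
HB.instance Definition _ := Choice.copy (cplx R) (can_type cplx_pairK).
End CplxChoice.

Lemma cplxP (R : Type) (z w : cplx R) : re z = re w -> im z = im w -> z = w.
Proof. by case: z w => [a b] [c d] /= -> ->. Qed.

Section CplxZmodule.
Variable R : zmodType.
Implicit Types z w : cplx R.
Definition cplx_zero : cplx R := Cplx 0 0.
Definition cplx_opp z : cplx R := Cplx (- re z) (- im z).
Definition cplx_add z w : cplx R := Cplx (re z + re w) (im z + im w).
Lemma cplx_addA : associative cplx_add.
Proof. by move=> a b c; apply/cplxP; rewrite /= addrA. Qed.
Lemma cplx_addC : commutative cplx_add.
Proof. by move=> a b; apply/cplxP; rewrite /= addrC. Qed.
Lemma cplx_add0 : left_id cplx_zero cplx_add.
Proof. by move=> a; apply/cplxP; rewrite /= add0r. Qed.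
Lemma cplx_addN : left_inverse cplx_zero cplx_opp cplx_add.
Proof. by move=> a; apply/cplxP; rewrite /= addNr. Qed.
HB.instance Definition _ := GRing.isZmodule.Build (cplx R)
  cplx_addA cplx_addC cplx_add0 cplx_addN.
End CplxZmodule.

Section CplxRing.
Variable R : comNzRingType.
Implicit Types z w : cplx R.
Definition cplx_one : cplx R := Cplx 1 0.
Definition cplx_mul z w : cplx R :=
  Cplx (re z * re w - im z * im w) (re z * im w + im z * re w).
Lemma cplx_mulA : associative cplx_mul.
Proof. by move=> a b c; apply/cplxP => /=; ring. Qed.
Lemma cplx_mulC : commutative cplx_mul.
Proof. by move=> a b; apply/cplxP => /=; ring. Qed.
Lemma cplx_mul1 : left_id cplx_one cplx_mul.
Proof. by move=> a; apply/cplxP => /=; ring. Qed.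
Lemma cplx_mulDl : left_distributive cplx_mul +%R.
Proof. by move=> a b c; apply/cplxP => /=; ring. Qed.
Lemma cplx_one_neq0 : cplx_one != 0.
Proof. by apply/eqP => -[/eqP]; rewrite oner_eq0. Qed.
HB.instance Definition _ := GRing.Zmodule_isComNzRing.Build (cplx R)
  cplx_mulA cplx_mulC cplx_mul1 cplx_mulDl cplx_one_neq0.

Definition conjc z : cplx R := Cplx (re z) (- im z).
Lemma conjcK : involutive conjc.
Proof. by move=> a; apply/cplxP; rewrite /= ?opprK. Qed.
Lemma conjcD z w : conjc (z + w) = conjc z + conjc w.
Proof. by apply/cplxP; rewrite //= opprD. Qed.
Lemma conjcM z w : conjc (z * w) = conjc z * conjc w.
Proof. by apply/cplxP => /=; ring. Qed.
Lemma conjc0 : conjc 0 = 0.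
Proof. by apply/cplxP; rewrite //= oppr0. Qed.
End CplxRing.

(* z >= 0 in C: z is real and non-negative *)
Definition cnonneg (R : realDomainType) (z : cplx R) : Prop := im z = 0 /\ 0 <= re z.

(* C[[lambda]] is [cplx (series R)], i.e. R[[lambda]](i); it acts on V[[lambda]]
   for every C-module V *)
Section SeriesModule.
Variable R : realDomainType.
Implicit Types z w : cplx (series R).

Definition zcoef z (n : nat) : cplx R := Cplx (scoef (re z) n) (scoef (im z) n).
Definition zconst (c : cplx R) : cplx (series R) := Cplx (ser_const (re c)) (ser_const (im c)).

Lemma zcoefP z w : (forall n, zcoef z n = zcoef w n) -> z = w.
Proof. by move=> h; apply/cplxP; apply/seriesP => n; case: (h n). Qed.
Lemma zcoefD z w n : zcoef (z + w) n = zcoef z n + zcoef w n. Proof. by []. Qed.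
Lemma zcoefM z w n : zcoef (z * w) n = \sum_(i < n.+1) zcoef z i * zcoef w (n - i)%N.
Proof.
have reS (F : 'I_n.+1 -> cplx R) : re (\sum_i F i) = \sum_i re (F i).
  by elim/big_rec2: _ => //= i x y _ <-.
have imS (F : 'I_n.+1 -> cplx R) : im (\sum_i F i) = \sum_i im (F i).
  by elim/big_rec2: _ => //= i x y _ <-.
by apply/cplxP; rewrite ?reS ?imS /= ?sumrB ?big_split.
Qed.
Lemma zcoef_conj z n : zcoef (conjc z) n = conjc (zcoef z n). Proof. by []. Qed.
Lemma zcoef_const0 c : zcoef (zconst c) 0 = c. Proof. by case: c. Qed.
Lemma zcoef_constS c n : zcoef (zconst c) n.+1 = 0. Proof. by []. Qed.
Lemma zcoefM0 z w : zcoef (z * w) 0 = zcoef z 0 * zcoef w 0.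
Proof. by rewrite zcoefM big_ord_recl big_ord0 addr0. Qed.

Lemma zcoefcM c z n : zcoef (zconst c * z) n = c * zcoef z n.
Proof.
by rewrite zcoefM big_ord_recl subn0 zcoef_const0 big1 ?addr0 // => i _; rewrite zcoef_constS mul0r.
Qed.
Lemma zconstD c d : zconst (c + d) = zconst c + zconst d.
Proof. by apply/zcoefP => -[|n]; rewrite zcoefD ?zcoef_const0 // !zcoef_constS addr0. Qed.
Lemma zconstM c d : zconst (c * d) = zconst c * zconst d.
Proof. by apply/zcoefP => -[|n]; rewrite zcoefcM ?zcoef_const0 // !zcoef_constS mulr0. Qed.
Lemma zconst1 : zconst 1 = 1.
Proof. by apply/zcoefP => -[|n]; apply/cplxP. Qed.

Variable V : lmodType (cplx R).
Implicit Types a b : series V.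

Definition ser_scale z a : series V :=
  Series (fun n => \sum_(i < n.+1) zcoef z i *: scoef a (n - i)%N).

Lemma ser_scaleA z w a : ser_scale z (ser_scale w a) = ser_scale (z * w) a.
Proof.
apply/seriesP => n /=.
transitivity (\sum_(i < n.+1) \sum_(k < i.+1)
   zcoef z k *: (zcoef w (i - k)%N *: scoef a (n - i)%N)).
  rewrite (sum_triangle n (fun i j k => zcoef z i *: (zcoef w j *: scoef a k))).
  by apply: eq_bigr => i _; rewrite scaler_sumr.
apply: eq_bigr => i _; rewrite zcoefM scaler_suml.
by apply: eq_bigr => j _; rewrite scalerA.
Qed.
Lemma ser_scale1 : left_id 1 ser_scale.
Proof.
move=> a; apply/seriesP => n /=; rewrite big_ord_recl subn0 -zconst1 zcoef_const0.
by rewrite scale1r big1 ?addr0 // => i _; rewrite zcoef_constS scale0r.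
Qed.
Lemma ser_scaleDr : right_distributive ser_scale +%R.
Proof.
move=> z a b; apply/seriesP => n /=; rewrite -big_split /=.
by apply: eq_bigr => i _; rewrite scalerDr.
Qed.
Lemma ser_scaleDl a : {morph ser_scale^~ a : z w / z + w}.
Proof.
move=> z w; apply/seriesP => n /=; rewrite -big_split /=.
by apply: eq_bigr => i _; rewrite zcoefD scalerDl.
Qed.
HB.instance Definition _ := GRing.Zmodule_isLmodule.Build (cplx (series R)) (series V)
  ser_scaleA ser_scale1 ser_scaleDr ser_scaleDl.

Lemma scoefZ z a n : scoef (z *: a) n = \sum_(i < n.+1) zcoef z i *: scoef a (n - i)%N.
Proof. by []. Qed.
Lemma scoefZ0 z a : scoef (z *: a) 0 = zcoef z 0 *: scoef a 0.
Proof. by rewrite scoefZ big_ord_recl big_ord0 addr0. Qed.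
Lemma scoefcZ c a n : scoef (zconst c *: a) n = c *: scoef a n.
Proof.
rewrite scoefZ big_ord_recl subn0 zcoef_const0 big1 ?addr0 // => i _.
by rewrite zcoef_constS scale0r.
Qed.
Lemma ser_constZ c (v : V) : ser_const (c *: v) = zconst c *: ser_const v.
Proof. by apply/seriesP => -[|n]; rewrite scoefcZ //= scaler0. Qed.
End SeriesModule.

Record submodule (K : nzRingType) (V : lmodType K) := Submodule {
  submod_mem :> V -> Prop;
  submod0 : submod_mem 0;
  submodD : forall u v, submod_mem u -> submod_mem v -> submod_mem (u + v);
  submodZ : forall c u, submod_mem u -> submod_mem (c *: u) }.

Section QuotientModule.
Variables (K : nzRingType) (V : lmodType K) (S : submodule V).

Lemma submodN u : S u -> S (- u).
Proof. by move=> Su; rewrite -scaleN1r; apply: submodZ. Qed.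

Definition submod_pred : V -> bool := fun u => `[< S u >].
Lemma submod_pred_closed : zmod_closed submod_pred.
Proof.
split=> [|u v /asboolP Su /asboolP Sv]; first exact/asboolP/submod0.
by apply/asboolP/submodD => //; apply: submodN.
Qed.
Definition submod_zmod : zmodClosed V :=
  HB.pack submod_pred (GRing.isZmodClosed.Build V submod_pred submod_pred_closed).

Definition quotmod : Type := Quotient.quot submod_zmod.
HB.instance Definition _ := GRing.Zmodule.on quotmod.

Definition qcl (u : V) : quotmod := \pi_(Quotient.quot submod_zmod)%qT u.
Definition qrepr (q : quotmod) : V := generic_quotient.repr q.

Lemma qreprK q : qcl (qrepr q) = q. Proof. exact: generic_quotient.reprK. Qed.

Lemma qcl_eq u v : qcl u = qcl v <-> S (u - v).
Proof.
split=> [/eqP|h]; last apply/eqP.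
  by rewrite /qcl -Quotient.idealrBE => /asboolP.
by rewrite /qcl -Quotient.idealrBE; apply/asboolP.
Qed.
Lemma qreprP u : S (qrepr (qcl u) - u).
Proof. by apply/qcl_eq; rewrite qreprK. Qed.
Lemma qclD u v : qcl (u + v) = qcl u + qcl v.
Proof. exact: (raddfD (\pi_(Quotient.quot submod_zmod)%qT)). Qed.

Definition qscale (c : K) (q : quotmod) : quotmod := qcl (c *: qrepr q).
Lemma qscaleE c u : qscale c (qcl u) = qcl (c *: u).
Proof. by apply/qcl_eq; rewrite -scalerBr; apply/submodZ/qreprP. Qed.

Lemma qscaleA c d q : qscale c (qscale d q) = qscale (c * d) q.
Proof. by rewrite -[q]qreprK !qscaleE scalerA. Qed.
Lemma qscale1 : left_id 1 qscale.
Proof. by move=> q; rewrite -[q]qreprK !qscaleE scale1r. Qed.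
Lemma qscaleDr : right_distributive qscale +%R.
Proof.
by move=> c p q; rewrite -[p]qreprK -[q]qreprK -qclD !qscaleE -qclD scalerDr.
Qed.
Lemma qscaleDl q : {morph qscale^~ q : c d / c + d}.
Proof. by move=> c d; rewrite -[q]qreprK !qscaleE -qclD scalerDl. Qed.
HB.instance Definition _ := GRing.Zmodule_isLmodule.Build K quotmod
  qscaleA qscale1 qscaleDr qscaleDl.

Lemma qclZ c u : qcl (c *: u) = c *: qcl u.
Proof. by rewrite -qscaleE. Qed.
Lemma qcl_is_linear : linear qcl.
Proof. by move=> c u v; rewrite qclD qclZ. Qed.
HB.instance Definition _ := GRing.isLinear.Build K V quotmod *:%R qcl qcl_is_linear.

Lemma qcl_ind (P : quotmod -> Prop) : (forall u, P (qcl u)) -> forall q, P q.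
Proof. by move=> h q; rewrite -[q]qreprK. Qed.
End QuotientModule.
Arguments qcl {K V} S u.
Arguments qcl_ind {K V} S P.

Definition qlift (K : nzRingType) (V : lmodType K) (S : submodule V) (T : Type)
  (f : V -> T) (q : quotmod S) : T := f (qrepr q).

Lemma qliftE (K : nzRingType) (V : lmodType K) (S : submodule V) (W : zmodType)
    (f : V -> W) (fB : forall u v, f (u - v) = f u - f v) (f0 : forall u, S u -> f u = 0) u :
  qlift f (qcl S u) = f u.
Proof. by apply/eqP; rewrite /qlift -subr_eq0 -fB; apply/eqP/f0/qreprP. Qed.

Section Span.
Variables (K : nzRingType) (V : lmodType K) (G : V -> Prop).
Definition in_span (v : V) : Prop := forall S : submodule V, (forall g, G g -> S g) -> S v.
Lemma in_span0 : in_span 0. Proof. by move=> S _; apply: submod0. Qed.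
Lemma in_spanD u v : in_span u -> in_span v -> in_span (u + v).
Proof. by move=> hu hv S h; apply: submodD; [apply: hu|apply: hv]. Qed.
Lemma in_spanZ c u : in_span u -> in_span (c *: u).
Proof. by move=> hu S h; apply: submodZ; apply: hu. Qed.
Definition span := Submodule in_span0 in_spanD in_spanZ.
End Span.

Section LinearProp.
Variables (K : nzRingType) (V W : lmodType K) (f : V -> W).
Variable fl : linear f.
Lemma lin0 : f 0 = 0.
Proof. by have := fl (-1) 0 0; rewrite scaler0 add0r scaleN1r addNr. Qed.
Lemma linD u v : f (u + v) = f u + f v.
Proof. by have := fl 1 u v; rewrite !scale1r. Qed.
Lemma linZ c u : f (c *: u) = c *: f u.
Proof. by have := fl c u 0; rewrite lin0 !addr0. Qed.
Lemma linB u v : f (u - v) = f u - f v.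
Proof. by rewrite linD -scaleN1r linZ scaleN1r. Qed.
Definition lker : submodule V.
refine (@Submodule _ _ (fun u => f u = 0) lin0 _ _).
- by move=> u v; rewrite linD => -> ->; rewrite addr0.
- by move=> c u; rewrite linZ => ->; rewrite scaler0.
Defined.
End LinearProp.

Lemma qlift_linear (K : nzRingType) (V W : lmodType K) (S : submodule V) (f : V -> W) :
  linear f -> (forall u, S u -> f u = 0) -> linear (qlift (S := S) f).
Proof.
move=> fl f0 c p q; rewrite -[p]qreprK -[q]qreprK.
by rewrite -linearP !(qliftE (linB fl) f0) fl.
Qed.

Lemma fglift_is_linear (K : nzRingType) (M : lmodType K) (T : choiceType) (f : T -> M) :
  linear (fglift f).
Proof.
move=> c u v.
have fD D1 D2 : fglift f (D1 + D2) = fglift f D1 + fglift f D2.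
  by have fB := lift_is_additive f; rewrite -{1}[D2]opprK -[- D2]sub0r !fB -(subrr 0) fB subrr sub0r opprK.
have f0 : fglift f 0 = 0 by rewrite -(subrr 0) lift_is_additive subrr.
have fS (I : Type) (r : seq I) (F : I -> {freeg T / K}) :
    fglift f (\sum_(i <- r) F i) = \sum_(i <- r) fglift f (F i).
  by elim: r => [|i r IH]; rewrite ?big_nil // !big_cons fD IH.
rewrite fD; congr (_ + _); rewrite -{2}[u]freeg_sumE /GRing.scale /= /fgscale !fS.
rewrite -[RHS]/(c *: _) scaler_sumr; apply: eq_bigr => x _.
by rewrite !liftU scalerA.
Qed.

Lemma freeg_ind1 (K : nzRingType) (T : choiceType) (P : {freeg T / K} -> Prop) :
  P 0 -> (forall u v, P u -> P v -> P (u + v)) -> (forall c x, P << c *g x >>) ->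
  forall u, P u.
Proof.
move=> P0 PD P1 u; rewrite -[u]freeg_sumE.
by elim: (dom u) => [|x r IH]; rewrite ?big_nil // big_cons; apply: PD.
Qed.

Lemma fgZU (K : nzRingType) (T : choiceType) (c d : K) (x : T) :
  c *: (<< d *g x >> : {freeg T / K}) = << c * d *g x >>.
Proof.
by apply/eqP/freeg_eqP => y; rewrite coeffZ !coeffU mulrA.
Qed.

Definition bilin (K : nzRingType) (U V W : lmodType K) (f : U -> V -> W) : Prop :=
  (forall u, linear (f u)) /\ (forall v, linear (f^~ v)).

Definition antilinear (R : comNzRingType) (U V : lmodType (cplx R)) (f : U -> V) : Prop :=
  forall c u v, f (c *: u + v) = conjc c *: f u + f v.

Definition qmap (K : nzRingType) (V W : lmodType K) (S : submodule V) (S' : submodule W)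
  (T : V -> W) : quotmod S -> quotmod S' := qlift (S := S) (fun u => qcl S' (T u)).

Lemma qmapE (K : nzRingType) (V W : lmodType K) (S : submodule V) (S' : submodule W)
    (T : V -> W) (Tl : linear T) (TS : forall u, S u -> S' (T u)) u :
  qmap S' T (qcl S u) = qcl S' (T u).
Proof.
apply: qliftE => [v w|v /TS Sv]; first by rewrite linB // linearB.
by rewrite -(linear0 (qcl S')); apply/qcl_eq; rewrite subr0.
Qed.

Lemma qmap_linear (K : nzRingType) (V W : lmodType K) (S : submodule V) (S' : submodule W)
    (T : V -> W) : linear T -> (forall u, S u -> S' (T u)) -> linear (qmap (S := S) S' T).
Proof.
move=> Tl TS c p q; rewrite -[p]qreprK -[q]qreprK -linearP !(qmapE Tl TS) Tl.
by rewrite linearP.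
Qed.

Record semiInner (R : realDomainType) (V : lmodType (cplx R)) := SemiInner {
  sform :> V -> V -> cplx R;
  sform_linear : forall u, scalar (sform u);
  sform_herm : forall u v, sform u v = conjc (sform v u);
  sform_ge0 : forall u, cnonneg (sform u u) }.

Record preHilbert (R : realDomainType) := PreHilbert {
  ph_sort :> lmodType (cplx R);
  ip : semiInner ph_sort;
  ip_def : forall u, ip u u = 0 -> u = 0 }.
Arguments ip {R} p.

Section SemiInnerTheory.
Variables (R : realDomainType) (V : lmodType (cplx R)) (f : semiInner V).

Lemma sformDr u v w : f u (v + w) = f u v + f u w.
Proof. by have := sform_linear f u 1 v w; rewrite scale1r mul1r. Qed.
Lemma sform0r u : f u 0 = 0.
Proof. by apply: (addrI (f u 0)); rewrite -sformDr !addr0. Qed.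
Lemma sformZr u c v : f u (c *: v) = c * f u v.
Proof. by have := sform_linear f u c v 0; rewrite sform0r !addr0. Qed.
Lemma sformDl u v w : f (v + w) u = f v u + f w u.
Proof. by rewrite sform_herm sformDr conjcD -!sform_herm. Qed.
Lemma sform0l u : f 0 u = 0.
Proof. by rewrite sform_herm sform0r conjc0. Qed.
Lemma sformZl u c v : f (c *: v) u = conjc c * f v u.
Proof. by rewrite sform_herm sformZr conjcM -sform_herm. Qed.

Lemma sformBl u v w : f (v - w) u = f v u - f w u.
Proof.
rewrite sformDl -scaleN1r sformZl; congr (_ + _).
by apply/cplxP => /=; ring.
Qed.

Lemma sformBr u v w : f u (v - w) = f u v - f u w.
Proof. by rewrite sformDr -scaleN1r sformZr mulN1r. Qed.

Lemma sform_degenerate u v : f u u = 0 -> f u v = 0.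
Proof.
move=> fu0; set z := f u v; pose m : R := re z ^+ 2 + im z ^+ 2.
pose q := re (f v v); have [imv q0] := sform_ge0 f v.
have m0 : 0 <= m by rewrite addr_ge0 ?sqr_ge0.
pose w := (Cplx (- (q + 1)) 0 * z) *: u + (Cplx m 0) *: v.
have [_] := sform_ge0 f w.
have -> : re (f w w) = - (m * m * (q + 2)).
  rewrite /w !(sformDl, sformDr, sformZl, sformZr) fu0 (sform_herm f v u) -/z.
  have -> : f v v = Cplx q 0 by apply/cplxP.
  by rewrite /=; rewrite /m /=; ring.
have mq : 0 <= m * m * (q + 2) by rewrite !mulr_ge0 // addr_ge0 // ler0n.
rewrite oppr_ge0 => h; have /eqP : m * m * (q + 2) = 0 by apply/le_anti; rewrite h mq.
rewrite !mulf_eq0 orbb (gt_eqF (_ : 0 < q + 2)) ?ltr_wpDl ?ltr0n // orbF.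
rewrite /m paddr_eq0 ?sqr_ge0 // !sqrf_eq0 => /andP[/eqP e1 /eqP e2].
by apply/cplxP.
Qed.

Definition radical : submodule V.
refine (@Submodule _ _ (fun u => forall v, f u v = 0) _ _ _).
- exact: sform0l.
- by move=> u v hu hv w; rewrite sformDl hu hv addr0.
- by move=> c u hu w; rewrite sformZl hu mulr0.
Defined.

Lemma radicalP u : radical u <-> f u u = 0.
Proof. by split=> [h|h v]; [apply: h|apply: sform_degenerate]. Qed.

Definition qform (p q : quotmod radical) : cplx R := f (qrepr p) (qrepr q).
Lemma qformE u v : qform (qcl _ u) (qcl _ v) = f u v.
Proof.
have hr u' w : f (qrepr (qcl radical u')) w = f u' w.
  by have /(_ w) := @qreprP _ _ radical u'; rewrite sformBl => /eqP; rewrite subr_eq0 => /eqP.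
by rewrite /qform hr sform_herm hr -sform_herm.
Qed.

Definition qsemiInner : semiInner (quotmod radical).
refine (@SemiInner _ _ qform _ _ _).
- move=> p c q r; rewrite -[p]qreprK -[q]qreprK -[r]qreprK -linearP !qformE.
  exact: sform_linear.
- by move=> p q; rewrite -[p]qreprK -[q]qreprK !qformE; apply: sform_herm.
- by move=> p; rewrite -[p]qreprK !qformE; apply: sform_ge0.
Defined.

Lemma qsemiInner_def p : qsemiInner p p = 0 -> p = 0.
Proof.
rewrite -[p]qreprK => /=; rewrite qformE => /radicalP h.
by rewrite -(linear0 (qcl radical)); apply/qcl_eq; rewrite subr0.
Qed.

(* V / V^perp *)
Definition phquot : preHilbert R := PreHilbert qsemiInner_def.
Definition phcl (u : V) : phquot := qcl radical u.
Definition phrepr (p : phquot) : V := qrepr p.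
Lemma phreprK p : phcl (phrepr p) = p. Proof. exact: qreprK. Qed.
Lemma phcl_linear : linear phcl. Proof. exact: (linearP (qcl radical)). Qed.
Lemma ip_phcl u v : ip phquot (phcl u) (phcl v) = f u v. Proof. exact: qformE. Qed.
Lemma phcl_eq u v : (forall w, f u w = f v w) -> phcl u = phcl v.
Proof.
move=> h; apply/qcl_eq => w.
by rewrite sformBl h subrr.
Qed.
End SemiInnerTheory.

(* not necessarily unital *)
Record starAlgebra (R : realDomainType) := StarAlgebra {
  sa_sort :> lmodType (cplx R);
  sa_mul : sa_sort -> sa_sort -> sa_sort;
  sa_star : sa_sort -> sa_sort;
  sa_mul_bilin : bilin sa_mul;
  sa_mulA : associative sa_mul;
  sa_star_antilin : antilinear sa_star;
  sa_starK : involutive sa_star;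
  sa_starM : forall a b, sa_star (sa_mul a b) = sa_mul (sa_star b) (sa_star a) }.

Definition positive_functional (R : realDomainType) (A : starAlgebra R)
    (w : A -> cplx R) : Prop :=
  scalar w /\ forall a, cnonneg (w (sa_mul (sa_star a) a)).

Definition sa_nonneg (R : realDomainType) (A : starAlgebra R) (a : A) : Prop :=
  sa_star a = a /\ forall w : A -> cplx R, positive_functional w -> cnonneg (w a).

(* mu = sum_r lambda^r mu_r and I = sum_r lambda^r I_r on A[[lambda]] *)
Definition ser_mul (V : zmodType) (mu : nat -> V -> V -> V) (a b : series V) : series V :=
  Series (fun n => \sum_(i < n.+1) \sum_(j < (n - i).+1)
                     mu (n - i - j)%N (scoef a i) (scoef b j)).

Definition ser_star (V : zmodType) (I : nat -> V -> V) (a : series V) : series V :=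
  Series (fun n => \sum_(i < n.+1) I (n - i)%N (scoef a i)).

Record deformation (R : realDomainType) (A : starAlgebra R) := Deformation {
  df_mul : nat -> A -> A -> A;
  df_star : nat -> A -> A;
  df_mul_bilin : forall r, bilin (df_mul r);
  df_star_antilin : forall r, antilinear (df_star r);
  df_mul0 : forall a b, df_mul 0 a b = sa_mul a b;
  df_star0 : forall a, df_star 0 a = sa_star a;
  df_mulA : associative (ser_mul df_mul);
  df_starK : involutive (ser_star df_star);
  df_starM : forall a b, ser_star df_star (ser_mul df_mul a b) =
    ser_mul df_mul (ser_star df_star b) (ser_star df_star a) }.

Section LinSum.
Variables (K : nzRingType) (V W : lmodType K) (f : V -> W).
Lemma lin_sum (fl : linear f) n (F : 'I_n -> V) : f (\sum_i F i) = \sum_i f (F i).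
Proof. by elim/big_rec2: _ => [|i x y _ <-]; [apply: lin0|apply: linD]. Qed.
End LinSum.

Section Antilinear.
Variables (R : comNzRingType) (V W : lmodType (cplx R)) (f : V -> W) (fl : antilinear f).
Lemma alinD u v : f (u + v) = f u + f v.
Proof.
have := fl 1 u v; have -> : conjc 1 = 1 :> cplx R by apply/cplxP; rewrite //= oppr0.
by rewrite !scale1r.
Qed.
Lemma alin0 : f 0 = 0.
Proof. by apply: (addrI (f 0)); rewrite -alinD !addr0. Qed.
Lemma alinZ c u : f (c *: u) = conjc c *: f u.
Proof. by have := fl c u 0; rewrite alin0 !addr0. Qed.
Lemma alin_sum n (F : 'I_n -> V) : f (\sum_i F i) = \sum_i f (F i).
Proof. by elim/big_rec2: _ => [|i x y _ <-]; [apply: alin0|apply: alinD]. Qed.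
End Antilinear.

Lemma linear_DZ (K : nzRingType) (V W : lmodType K) (f : V -> W) :
  (forall u v, f (u + v) = f u + f v) -> (forall c u, f (c *: u) = c *: f u) -> linear f.
Proof. by move=> fD fZ c u v; rewrite fD fZ. Qed.

Section Deformed.
Variables (R : realDomainType) (A : starAlgebra R) (D : deformation A).

Lemma ser_mul_linl (b : series A) : linear ((ser_mul (df_mul D))^~ b).
Proof.
apply: linear_DZ => [a a'|c a]; apply/seriesP => n.
  rewrite scoefD /= -big_split /=; apply: eq_bigr => i _.
  rewrite -big_split /=; apply: eq_bigr => j _.
  exact: (linD ((df_mul_bilin D _).2 _)).
rewrite scoefZ /=.
transitivity (\sum_(i < n.+1) \sum_(k < i.+1) zcoef c k *:
   (\sum_(j < (n - i).+1) df_mul D (n - i - j) (scoef a (i - k)%N) (scoef b j))).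
  apply: eq_bigr => i _; rewrite -[LHS]/(\sum_(j < _) _).
  under [RHS]eq_bigr do rewrite scaler_sumr.
  rewrite exchange_big /=; apply: eq_bigr => j _.
  rewrite (lin_sum ((df_mul_bilin D _).2 _)); apply: eq_bigr => k _.
  exact: (linZ ((df_mul_bilin D _).2 _)).
rewrite (sum_triangle n (fun k l m => zcoef c k *: (\sum_(j < m.+1) 
   df_mul D (m - j) (scoef a l) (scoef b j)))).
by apply: eq_bigr => k _; rewrite scaler_sumr.
Qed.

Lemma ser_mul_linr (a : series A) : linear (ser_mul (df_mul D) a).
Proof.
apply: linear_DZ => [b b'|c b]; apply/seriesP => n.
  rewrite scoefD /= -big_split /=; apply: eq_bigr => i _.
  rewrite -big_split /=; apply: eq_bigr => j _.
  exact: (linD ((df_mul_bilin D _).1 _)).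
rewrite scoefZ /=.
transitivity (\sum_(i < n.+1) \sum_(k < (n - i).+1) zcoef c k *:
   (\sum_(l < (n - i - k).+1) df_mul D (n - i - k - l) (scoef a i) (scoef b l))).
  apply: eq_bigr => i _.
  transitivity (\sum_(j < (n - i).+1) \sum_(k < j.+1) zcoef c k *:
    df_mul D (n - i - j) (scoef a i) (scoef b (j - k)%N)).
    apply: eq_bigr => j _; rewrite (lin_sum ((df_mul_bilin D _).1 _)).
    by apply: eq_bigr => k _; rewrite (linZ ((df_mul_bilin D _).1 _)).
  rewrite (sum_triangle (n - i) (fun k l m => zcoef c k *:
     df_mul D m (scoef a i) (scoef b l))).
  by apply: eq_bigr => k _; rewrite scaler_sumr.
rewrite (sum_triangleC n (fun i k m => zcoef c k *:
   (\sum_(l < m.+1) df_mul D (m - l) (scoef a i) (scoef b l)))).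
by apply: eq_bigr => k _; rewrite scaler_sumr.
Qed.

Lemma ser_star_antilin : antilinear (ser_star (df_star D)).
Proof.
move=> c a b; apply/seriesP => n.
rewrite scoefD scoefZ /=.
transitivity (\sum_(i < n.+1) (\sum_(k < i.+1) conjc (zcoef c k) *:
   df_star D (n - i) (scoef a (i - k)%N) + df_star D (n - i) (scoef b i))).
  apply: eq_bigr => i _; rewrite (alinD (df_star_antilin D _)); congr (_ + _).
  rewrite (alin_sum (df_star_antilin D _)); apply: eq_bigr => k _.
  by rewrite (alinZ (df_star_antilin D _)).
rewrite big_split /=; congr (_ + _).
rewrite (sum_triangle n (fun k l m => conjc (zcoef c k) *: df_star D m (scoef a l))).
by apply: eq_bigr => k _; rewrite scaler_sumr.
Qed.

(* the *-algebra (A[[lambda]], mu, I) over C[[lambda]] *)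
Definition deformed : starAlgebra (series R) :=
  @StarAlgebra (series R) (series A) (ser_mul (df_mul D)) (ser_star (df_star D))
    (conj ser_mul_linr ser_mul_linl) (@df_mulA _ _ D) ser_star_antilin
    (@df_starK _ _ D) (@df_starM _ _ D).

(* the classical limit A[[lambda]] -> A and the embedding A -> A[[lambda]] *)
Definition cl_alg (a : deformed) : A := scoef (a : series A) 0.
Definition const_alg (a : A) : deformed := ser_const a.

Lemma cl_algM (a b : deformed) : cl_alg (sa_mul a b) = sa_mul (cl_alg a) (cl_alg b).
Proof. by rewrite /cl_alg /= !big_ord_recl !big_ord0 !addr0 df_mul0. Qed.
Lemma cl_alg_star (a : deformed) : cl_alg (sa_star a) = sa_star (cl_alg a).
Proof. by rewrite /cl_alg /= !big_ord_recl !big_ord0 !addr0 df_star0. Qed.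
Lemma cl_algD (a b : deformed) : cl_alg (a + b) = cl_alg a + cl_alg b.
Proof. by []. Qed.
Lemma cl_algZ c (a : deformed) : cl_alg (c *: a) = zcoef c 0 *: cl_alg a.
Proof. exact: scoefZ0. Qed.
Lemma const_algK (a : A) : cl_alg (const_alg a) = a. Proof. by []. Qed.
Lemma const_algD a b : const_alg (a + b) = const_alg a + const_alg b.
Proof. exact: ser_constD. Qed.
Lemma const_algZ c a : const_alg (c *: a) = zconst c *: const_alg a.
Proof. exact: ser_constZ. Qed.
End Deformed.


Section Lambda.
Variables (R : realDomainType).
Definition lambda : cplx (series R) := Cplx (Series (fun n => (n == 1%N)%:R)) 0.
Lemma lambda0 : zcoef lambda 0 = 0. Proof. by []. Qed.

Lemma ser_lambdaP (V : lmodType (cplx R)) (a : series V) :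
  scoef a 0 = 0 -> exists b : series V, a = lambda *: b.
Proof.
move=> a0; exists (Series (fun n => scoef a n.+1)); apply/seriesP => n.
rewrite scoefZ big_ord_recl lambda0 scale0r add0r.
case: n => [|n]; first by rewrite big_ord0.
rewrite big_ord_recl big1 ?addr0 => [|i _] /=.
  have -> : zcoef lambda (bump 0 0) = 1 by apply/cplxP.
  by rewrite scale1r subSS subn0.
have -> : zcoef lambda (bump 0 (bump 0 i)) = 0 by apply/cplxP.
by rewrite scale0r.
Qed.
End Lambda.

Record category := Category {
  ob :> Type;
  hom : ob -> ob -> Type;
  id_hom : forall a, hom a a;
  comp_hom : forall a b d, hom b d -> hom a b -> hom a d;
  comp_id_l : forall a b (f : hom a b), comp_hom (id_hom b) f = f;
  comp_id_r : forall a b (f : hom a b), comp_hom f (id_hom a) = f;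
  comp_assoc : forall a b c d (f : hom c d) (g : hom b c) (h : hom a b),
    comp_hom f (comp_hom g h) = comp_hom (comp_hom f g) h }.
Arguments hom {_}.
Arguments id_hom {_}.
Arguments comp_hom {_ _ _ _}.

Record functor (C D : category) := Functor {
  fob :> C -> D;
  fmap : forall a b : C, hom a b -> hom (fob a) (fob b);
  fmap_id : forall a : C, fmap (id_hom a) = id_hom (fob a);
  fmap_comp : forall (a b c : C) (f : hom b c) (g : hom a b),
    fmap (comp_hom f g) = comp_hom (fmap f) (fmap g) }.
Arguments fmap {_ _} _ {_ _}.

Section CompFunctor.
Variables (C D E : category) (G : functor D E) (F : functor C D).
Definition comp_functor : functor C E.
refine (@Functor C E (fun a => G (F a)) (fun a b f => fmap G (fmap F f)) _ _).
- by move=> a; rewrite !fmap_id.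
- by move=> a b c f g; rewrite !fmap_comp.
Defined.
End CompFunctor.

Record natIso (C D : category) (F G : functor C D) := NatIso {
  nat_fwd : forall a : C, hom (F a) (G a);
  nat_bwd : forall a : C, hom (G a) (F a);
  nat_fwdK : forall a, comp_hom (nat_bwd a) (nat_fwd a) = id_hom (F a);
  nat_bwdK : forall a, comp_hom (nat_fwd a) (nat_bwd a) = id_hom (G a);
  nat_comm : forall (a b : C) (f : hom a b),
    comp_hom (nat_fwd b) (fmap F f) = comp_hom (fmap G f) (nat_fwd a) }.

Record starRep (R : realDomainType) (A : starAlgebra R) := StarRep {
  rep_space :> preHilbert R;
  rep_op : A -> rep_space -> rep_space;
  rep_bilin : bilin rep_op;
  rep_mul : forall a b u, rep_op (sa_mul a b) u = rep_op a (rep_op b u);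
  rep_adj : forall a u v, ip rep_space (rep_op a u) v = ip rep_space u (rep_op (sa_star a) v) }.

Definition isometric (R : realDomainType) (V W : lmodType (cplx R))
    (f : semiInner V) (g : semiInner W) (T : V -> W) : Prop :=
  forall u v, g (T u) (T v) = f u v.

Definition adjoint_pair (R : realDomainType) (V W : lmodType (cplx R))
    (f : semiInner V) (g : semiInner W) (T : V -> W) (S : W -> V) : Prop :=
  forall u w, g (T u) w = f u (S w).

Definition adjointable (R : realDomainType) (V W : lmodType (cplx R))
    (f : semiInner V) (g : semiInner W) (T : V -> W) : Prop :=
  exists S : W -> V, adjoint_pair f g T S.

Definition unitary (R : realDomainType) (V W : lmodType (cplx R))
    (f : semiInner V) (g : semiInner W) (T : V -> W) : Prop :=
  exists S : W -> V, [/\ adjoint_pair f g T S, cancel T S & cancel S T].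

Inductive homKind := Isometric | Adjointable | Unitary.

Definition has_kind (k : homKind) (R : realDomainType) (H H' : preHilbert R) (T : H -> H') :=
  match k with
  | Isometric => isometric (ip H) (ip H') T
  | Adjointable => adjointable (ip H) (ip H') T
  | Unitary => unitary (ip H) (ip H') T
  end.

Record intertwiner (k : homKind) (R : realDomainType) (A : starAlgebra R) (H H' : starRep A) :=
  Intertwiner {
    itw :> H -> H';
    itw_linear : linear itw;
    itw_comm : forall a u, itw (rep_op a u) = rep_op a (itw u);
    itw_kind : has_kind k itw }.

Section RepCategory.
Variables (k : homKind) (R : realDomainType) (A : starAlgebra R).
Implicit Types H : starRep A.

Lemma itw_ext H H' (S T : intertwiner k H H') : (forall u, S u = T u) -> S = T.
Proof.
case: S T => [S Sl Sc Sk] [T Tl Tc Tk] /= /funext e; subst T.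
by congr Intertwiner; apply: Prop_irrelevance.
Qed.

Lemma has_kind_id (H : preHilbert R) : has_kind k (fun u : H => u).
Proof. by case: k => //; exists id. Qed.

Lemma has_kind_comp (H1 H2 H3 : preHilbert R) (S : H2 -> H3) (T : H1 -> H2) :
  has_kind k S -> has_kind k T -> has_kind k (fun u => S (T u)).
Proof.
case: k => /= [hS hT u v|[S' hS] [T' hT]|[S' [hS SK KS]] [T' [hT TK KT]]].
- by rewrite hS hT.
- by exists (fun w => T' (S' w)) => u w; rewrite hS hT.
- exists (fun w => T' (S' w)); split=> [u w|u|w]; first by rewrite hS hT.
    by rewrite SK TK.
  by rewrite KT KS.
Qed.

Definition id_itw H : intertwiner k H H :=
  @Intertwiner k R A H H (fun u => u) (fun _ _ _ => erefl) (fun _ _ => erefl) (has_kind_id H).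

Definition comp_itw H1 H2 H3 (S : intertwiner k H2 H3) (T : intertwiner k H1 H2) :
  intertwiner k H1 H3.
refine (@Intertwiner k R A H1 H3 (fun u => S (T u)) _ _ _).
- by move=> c u v; rewrite !itw_linear.
- by move=> a u; rewrite !itw_comm.
- exact: has_kind_comp (itw_kind S) (itw_kind T).
Defined.

Definition repCat : category.
refine (@Category (starRep A) (@intertwiner k R A) id_itw comp_itw _ _ _).
- by move=> H H' T; apply: itw_ext.
- by move=> H H' T; apply: itw_ext.
- by move=> H1 H2 H3 H4 S T U; apply: itw_ext.
Defined.
End RepCategory.

Section Adjoint.
Variables (R : realDomainType).

Lemma ip_inj (H : preHilbert R) (u v : H) : (forall w, ip H w u = ip H w v) -> u = v.
Proof.
move=> h; apply/eqP; rewrite -subr_eq0; apply/eqP/ip_def.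
by rewrite sformBr h subrr.
Qed.

Lemma adjoint_linear (H H' : preHilbert R) (T : H -> H') (S : H' -> H) :
  adjoint_pair (ip H) (ip H') T S -> linear S.
Proof.
move=> adj c u v; apply: ip_inj => w.
by rewrite -adj !(sformDr, sformZr) !adj.
Qed.

Lemma adjoint_comm (A : starAlgebra R) (H H' : starRep A) (T : H -> H') (S : H' -> H) :
  (forall a u, T (rep_op a u) = rep_op a (T u)) ->
  adjoint_pair (ip H) (ip H') T S -> forall a u, S (rep_op a u) = rep_op a (S u).
Proof.
move=> Tc adj a u; apply: ip_inj => w.
by rewrite -adj -{1}[a]sa_starK -rep_adj -Tc adj rep_adj sa_starK.
Qed.
End Adjoint.

Section PhMap.
Variables (R : realDomainType) (V W : lmodType (cplx R)).
Variables (f : semiInner V) (g : semiInner W).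

Definition phmap (T : V -> W) (p : phquot f) : phquot g := phcl g (T (phrepr p)).

Lemma phmapE (T : V -> W) u : linear T -> (forall u, radical f u -> radical g (T u)) ->
  phmap T (phcl f u) = phcl g (T u).
Proof. by move=> Tl Tr; apply: (qmapE Tl Tr). Qed.

Lemma phmap_linear (T : V -> W) : linear T -> (forall u, radical f u -> radical g (T u)) ->
  linear (phmap T).
Proof. by move=> Tl Tr; apply: (qmap_linear Tl Tr). Qed.
End PhMap.
Arguments phmap {R V W} f g T p.

Lemma adjoint_radical (R : realDomainType) (V W : lmodType (cplx R))
    (f : semiInner V) (g : semiInner W) (T : V -> W) (S : W -> V) :
  adjoint_pair f g T S -> forall u, radical f u -> radical g (T u).
Proof. by move=> adj u hu w; rewrite adj; apply: hu. Qed.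

Lemma adjoint_sym (R : realDomainType) (V W : lmodType (cplx R))
    (f : semiInner V) (g : semiInner W) (T : V -> W) (S : W -> V) :
  adjoint_pair f g T S -> adjoint_pair g f S T.
Proof. by move=> adj w u; rewrite sform_herm -adj -sform_herm. Qed.

Lemma isometric_radical (R : realDomainType) (V W : lmodType (cplx R))
    (f : semiInner V) (g : semiInner W) (T : V -> W) :
  isometric f g T -> forall u, radical f u -> radical g (T u).
Proof. by move=> iso u hu; apply/radicalP; rewrite iso; apply: hu. Qed.

Section PhMapKind.
Variables (k : homKind) (R : realDomainType) (V W : lmodType (cplx R)).
Variables (f : semiInner V) (g : semiInner W) (T : V -> W) (Tl : linear T).

(* the conditions on T that make phmap T a morphism of kind k *)
Definition pre_kind : Prop :=
  match k with
  | Isometric => isometric f g T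
  | Adjointable => exists2 S : W -> V, linear S & adjoint_pair f g T S
  | Unitary => exists2 S : W -> V, linear S & [/\ adjoint_pair f g T S, cancel T S & cancel S T]
  end.

Lemma pre_kind_radical : pre_kind -> forall u, radical f u -> radical g (T u).
Proof.
rewrite /pre_kind; case: k => [|[S _ adj]|[S _ [adj _ _]]].
- exact: isometric_radical.
- exact: adjoint_radical adj.
- exact: adjoint_radical adj.
Qed.

Lemma has_kind_phmap : pre_kind -> has_kind k (phmap f g T).
Proof.
move=> hk; have := pre_kind_radical hk; move: hk; rewrite /pre_kind; case: k => /=.
- move=> iso Tr p q; rewrite -[p]phreprK -[q]phreprK !phmapE //.
  exact: etrans (ip_phcl _ _ _) (etrans (iso _ _) (esym (ip_phcl _ _ _))).
- case=> S Sl adj Tr; have Sr := adjoint_radical (adjoint_sym adj).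
  exists (phmap g f S) => p q; rewrite -[p]phreprK -[q]phreprK !phmapE //.
  exact: etrans (ip_phcl _ _ _) (etrans (adj _ _) (esym (ip_phcl _ _ _))).
- case=> S Sl [adj TS ST] Tr; have Sr := adjoint_radical (adjoint_sym adj).
  exists (phmap g f S); split=> [p q|p|q].
  + rewrite -[p]phreprK -[q]phreprK !phmapE //.
    exact: etrans (ip_phcl _ _ _) (etrans (adj _ _) (esym (ip_phcl _ _ _))).
  + by rewrite -[p]phreprK !phmapE // TS.
  + by rewrite -[q]phreprK !phmapE // ST.
Qed.
End PhMapKind.

(* an action on V that is a *-representation modulo V^perp *)
Section PhRep.
Variables (R : realDomainType) (A : starAlgebra R) (V : lmodType (cplx R)).
Variables (f : semiInner V) (op : A -> V -> V).

Record preRep : Prop := PreRep {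
  prerep_bilin : bilin op;
  prerep_mul : forall a b u v, f (op (sa_mul a b) u) v = f (op a (op b u)) v;
  prerep_adj : forall a u v, f (op a u) v = f u (op (sa_star a) v) }.

Definition phrep_op (a : A) : phquot f -> phquot f := phmap f f (op a).

Variable (h : preRep).
Lemma prerep_radical a u : radical f u -> radical f (op a u).
Proof. by move=> hu v; rewrite (prerep_adj h); apply: hu. Qed.
Lemma phrep_opE a u : phrep_op a (phcl f u) = phcl f (op a u).
Proof. exact: (phmapE _ ((prerep_bilin h).1 a) (@prerep_radical a)). Qed.

Definition phrep : starRep A.
refine (@StarRep R A (phquot f) phrep_op _ _ _).
- split=> [a|p].
    exact: (phmap_linear ((prerep_bilin h).1 a) (@prerep_radical a)).
  move=> c a b; rewrite -[p]phreprK !phrep_opE ((prerep_bilin h).2 _).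
  exact: phcl_linear.
- move=> a b p; rewrite -[p]phreprK !phrep_opE; apply: phcl_eq => w.
  exact: prerep_mul.
- move=> a p q; rewrite -[p]phreprK -[q]phreprK !phrep_opE !ip_phcl.
  exact: prerep_adj.
Defined.
End PhRep.

(* a (B-A)-bimodule with an A-valued inner product satisfying X1, X2, X3, X5 *)
Record innerBimodule (R : realDomainType) (B A : starAlgebra R) := InnerBimodule {
  bm_sort :> lmodType (cplx R);
  bm_l : B -> bm_sort -> bm_sort;
  bm_r : bm_sort -> A -> bm_sort;
  bm_l_bilin : bilin bm_l;
  bm_r_bilin : bilin bm_r;
  bm_lM : forall b b' x, bm_l (sa_mul b b') x = bm_l b (bm_l b' x);
  bm_rM : forall x a a', bm_r x (sa_mul a a') = bm_r (bm_r x a) a';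
  bm_lr : forall b x a, bm_r (bm_l b x) a = bm_l b (bm_r x a);
  bm_ip : bm_sort -> bm_sort -> A;
  bm_X1 : forall x, linear (bm_ip x);
  bm_X2 : forall x y, bm_ip x y = sa_star (bm_ip y x);
  bm_X3 : forall x y a, bm_ip x (bm_r y a) = sa_mul (bm_ip x y) a;
  bm_X5 : forall x b y, bm_ip x (bm_l b y) = bm_ip (bm_l (sa_star b) x) y }.

Definition axiomX4 (R : realDomainType) (B A : starAlgebra R) (X : innerBimodule B A) : Prop :=
  forall x : X, sa_nonneg (bm_ip x x).

Section Tensor.
Variables (R : realDomainType) (B A : starAlgebra R) (X : innerBimodule B A) (H : starRep A).
Local Notation C := (cplx R).

(* A need not be unital, so C-balancedness is imposed along with A-balancedness. *)
Inductive tens_rel : {freeg (X * H)%type / C} -> Prop :=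
| tens_relDl x y u : tens_rel (<< (x + y, u) >> - << (x, u) >> - << (y, u) >>)
| tens_relDr x u v : tens_rel (<< (x, u + v) >> - << (x, u) >> - << (x, v) >>)
| tens_relZl c x u : tens_rel (<< (c *: x, u) >> - c *: << (x, u) >>)
| tens_relZr c x u : tens_rel (<< (x, c *: u) >> - c *: << (x, u) >>)
| tens_relA x a u : tens_rel (<< (bm_r x a, u) >> - << (x, rep_op a u) >>).

Definition tensor := quotmod (span tens_rel).
HB.instance Definition _ := GRing.Lmodule.on tensor.

Definition tens (x : X) (u : H) : tensor := qcl (span tens_rel) << (x, u) >>.

Lemma tens_relP r : tens_rel r -> qcl (span tens_rel) r = 0.
Proof.
move=> h; rewrite -(linear0 (qcl (span tens_rel))); apply/qcl_eq; rewrite subr0.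
by move=> S; apply.
Qed.
Lemma tensDl x y u : tens (x + y) u = tens x u + tens y u.
Proof.
apply/eqP; rewrite -subr_eq0 opprD addrA -!linearB; apply/eqP/tens_relP.
exact: tens_relDl.
Qed.
Lemma tensDr x u v : tens x (u + v) = tens x u + tens x v.
Proof.
apply/eqP; rewrite -subr_eq0 opprD addrA -!linearB; apply/eqP/tens_relP.
exact: tens_relDr.
Qed.
Lemma tensZl c x u : tens (c *: x) u = c *: tens x u.
Proof.
apply/eqP; rewrite -subr_eq0 -linearZ -linearB; apply/eqP/tens_relP.
exact: tens_relZl.
Qed.
Lemma tensZr c x u : tens x (c *: u) = c *: tens x u.
Proof.
apply/eqP; rewrite -subr_eq0 -linearZ -linearB; apply/eqP/tens_relP.
exact: tens_relZr.
Qed.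
Lemma tensA x a u : tens (bm_r x a) u = tens x (rep_op a u).
Proof.
apply/eqP; rewrite -subr_eq0 -linearB; apply/eqP/tens_relP.
exact: tens_relA.
Qed.

Lemma tens_ind (P : tensor -> Prop) :
  (forall s t, P s -> P t -> P (s + t)) -> (forall x u, P (tens x u)) -> forall t, P t.
Proof.
move=> PD P1 t; rewrite -[t](qreprK (S := span tens_rel)).
elim/freeg_ind1: (qrepr t) => [|u v hu hv|c [x u]].
- suff -> : qcl (span tens_rel) 0 = tens 0 0 by apply: P1.
  by rewrite -[in RHS](scale0r 0) tensZl scale0r linear0.
- by rewrite linearD; apply: PD.
- suff -> : qcl (span tens_rel) << c *g (x, u) >> = tens (c *: x) u by apply: P1.
  by rewrite tensZl /tens -linearZ fgZU mulr1.
Qed.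

Section Lift.
Variables (W : lmodType C) (f : X -> H -> W).

Record balanced : Prop := Balanced {
  bal_bilin : bilin f;
  bal_A : forall x a u, f (bm_r x a) u = f x (rep_op a u) }.

Definition tlift : tensor -> W := qlift (S := span tens_rel) (fglift (fun p => f p.1 p.2)).

Variable (h : balanced).
Let F := fglift (fun p : X * H => f p.1 p.2).
Let Fl : linear F. Proof. exact: fglift_is_linear. Qed.
Let F1 x u : F << (x, u) >> = f x u. Proof. by rewrite /F liftU scale1r. Qed.

Lemma tlift_rel r : span tens_rel r -> F r = 0.
Proof.
move=> hr; apply: (hr (lker Fl)) => _ [x y u|x u v|c x u|c x u|x a u] /=.
- by rewrite !(linB Fl) !F1 (linD ((bal_bilin h).2 _)) addrAC addrK subrr.
- by rewrite !(linB Fl) !F1 (linD ((bal_bilin h).1 _)) addrAC addrK subrr.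
- by rewrite (linB Fl) (linZ Fl) !F1 (linZ ((bal_bilin h).2 _)) subrr.
- by rewrite (linB Fl) (linZ Fl) !F1 (linZ ((bal_bilin h).1 _)) subrr.
- by rewrite (linB Fl) !F1 (bal_A h) subrr.
Qed.

Lemma tlift_linear : linear tlift.
Proof. exact: (qlift_linear Fl tlift_rel). Qed.
Lemma tliftE x u : tlift (tens x u) = f x u.
Proof. by rewrite /tlift /tens (qliftE (linB Fl) tlift_rel) F1. Qed.
End Lift.

Lemma tens_lin_ext (W : lmodType C) (f g : tensor -> W) : linear f -> linear g ->
  (forall x u, f (tens x u) = g (tens x u)) -> forall t, f t = g t.
Proof.
move=> fl gl h; apply: tens_ind => // s t hs ht.
by rewrite (linD fl) (linD gl) hs ht.
Qed.
End Tensor.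
Arguments tens {R B A X H} x u.


Section TensorForm.
Variables (R : realDomainType) (B A : starAlgebra R) (X : innerBimodule B A) (H : starRep A).
Local Notation C := (cplx R).

Definition tform_r (y : X) (v : H) (s : tensor X H) : C^o :=
  conjc (tlift (W := C^o) (fun x u => ip H v (rep_op (bm_ip y x) u)) s).

(* the form determined by <x (x) u, y (x) v> = <u, pi(<x,y>) v>, see [tform_tens] *)
Definition tform (s t : tensor X H) : C :=
  tlift (W := C^o) (fun y v => tform_r y v s) t.

Lemma tform_r_bal y v : balanced (W := C^o) (fun (x : X) u => ip H v (rep_op (bm_ip y x) u)).
Proof.
split=> [|x a u]; last by rewrite bm_X3 rep_mul.
split=> [x c u u'|u c x x'].
  by rewrite (rep_bilin H).1 sformDr sformZr.
by rewrite (bm_X1 y) (rep_bilin H).2 sformDr sformZr.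
Qed.

Lemma tform_rD y v s t : tform_r y v (s + t) = tform_r y v s + tform_r y v t.
Proof. by rewrite /tform_r (linD (tlift_linear (tform_r_bal y v))) conjcD. Qed.

Lemma tform_r_tens y v x u : tform_r y v (tens x u) = ip H u (rep_op (bm_ip x y) v).
Proof.
rewrite /tform_r (tliftE (tform_r_bal y v)) -sform_herm rep_adj.
by rewrite -bm_X2.
Qed.

Lemma tform_bal s : balanced (W := C^o) (fun y v => tform_r y v s).
Proof.
split; first split.
- move=> y c v v'; elim/tens_ind: s => [s t hs ht|x u].
    by rewrite !tform_rD hs ht scalerDr addrACA.
  by rewrite !tform_r_tens (rep_bilin H).1 sformDr sformZr.
- move=> v c y y'; elim/tens_ind: s => [s t hs ht|x u].
    by rewrite !tform_rD hs ht scalerDr addrACA.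
  by rewrite !tform_r_tens (bm_X1 x) (rep_bilin H).2 sformDr sformZr.
- move=> y a v; elim/tens_ind: s => [s t hs ht|x u].
    by rewrite !tform_rD hs ht.
  by rewrite !tform_r_tens bm_X3 rep_mul.
Qed.

Lemma tform_tens x u y v : tform (tens x u) (tens y v) = ip H u (rep_op (bm_ip x y) v).
Proof. by rewrite /tform (tliftE (tform_bal _)) tform_r_tens. Qed.

Lemma tform_linear s : scalar (tform s).
Proof. exact: (tlift_linear (tform_bal s)). Qed.

Lemma tformDr s t t' : tform s (t + t') = tform s t + tform s t'.
Proof. exact: (linD (tlift_linear (tform_bal s))). Qed.

Lemma tformDl s s' t : tform (s + s') t = tform s t + tform s' t.
Proof.
elim/tens_ind: t => [t t' ht ht'|y v]; first by rewrite !tformDr ht ht' addrACA.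
by rewrite /tform !(tliftE (tform_bal _)) tform_rD.
Qed.

Lemma tform_herm s t : tform s t = conjc (tform t s).
Proof.
elim/tens_ind: s => [s s' hs hs'|x u]; first by rewrite tformDl tformDr conjcD hs hs'.
elim/tens_ind: t => [t t' ht ht'|y v]; first by rewrite tformDl tformDr conjcD ht ht'.
by rewrite !tform_tens -sform_herm rep_adj -bm_X2.
Qed.
End TensorForm.

Definition axiomP (R : realDomainType) (B A : starAlgebra R) (X : innerBimodule B A) : Prop :=
  forall (H : starRep A) (t : tensor X H), cnonneg (tform t t).

Section Rieffel.
Variables (R : realDomainType) (B A : starAlgebra R) (X : innerBimodule B A).
Variable (hP : axiomP X).
Implicit Types H : starRep A.

Definition rieffel_form H : semiInner (tensor X H) :=
  SemiInner (@tform_linear _ _ _ X H) (@tform_herm _ _ _ X H) (@hP H).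

Definition rieffel_op H (b : B) : tensor X H -> tensor X H :=
  tlift (fun x u => tens (bm_l b x) u).

Lemma rieffel_op_bal H b : balanced (H := H) (fun (x : X) u => tens (bm_l b x) u).
Proof.
split=> [|x a u]; last by rewrite -bm_lr tensA.
split=> [x c u u'|u c x x']; first by rewrite tensDr tensZr.
by rewrite (bm_l_bilin X).1 tensDl tensZl.
Qed.

Lemma rieffel_opE H b x u : @rieffel_op H b (tens x u) = tens (bm_l b x) u.
Proof. exact: (tliftE (rieffel_op_bal H b)). Qed.

Lemma rieffel_op_linear H b : linear (@rieffel_op H b).
Proof. exact: tlift_linear (rieffel_op_bal H b). Qed.

Lemma rieffel_op_bilin H : bilin (@rieffel_op H).
Proof.
have l b := rieffel_op_linear (H := H) b.
split=> // t c b b'; elim/tens_ind: t => [s t hs ht|x u].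
  by rewrite !(linD (l _)) hs ht scalerDr addrACA.
by rewrite !rieffel_opE (bm_l_bilin X).2 tensDl tensZl.
Qed.

Lemma rieffel_preRep H : preRep (rieffel_form H) (@rieffel_op H).
Proof.
have l b := linD (rieffel_op_linear (H := H) b).
split; first exact: rieffel_op_bilin.
- move=> a b s t; congr (tform _ _).
  elim/tens_ind: s => [s s' hs hs'|x u]; first by rewrite !l hs hs'.
  by rewrite !rieffel_opE bm_lM.
- move=> b s t /=.
  elim/tens_ind: s => [s s' hs hs'|x u]; first by rewrite l !tformDl hs hs'.
  elim/tens_ind: t => [t t' ht ht'|y v]; first by rewrite l !tformDr ht ht'.
  by rewrite !rieffel_opE !tform_tens bm_X5 sa_starK.
Qed.

Definition rieffel_rep H : starRep B := phrep (rieffel_preRep H).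

Definition rtens H (x : X) (u : H) : rieffel_rep H := phcl (rieffel_form H) (tens x u).

Lemma rieffel_rep_opE H b x (u : H) : rep_op b (rtens x u) = rtens (bm_l b x) u.
Proof. by rewrite /rtens -rieffel_opE; apply: (phrep_opE (rieffel_preRep H)). Qed.

Lemma ip_rtens H x y (u v : H) :
  ip (rieffel_rep H) (rtens x u) (rtens y v) = ip H u (rep_op (bm_ip x y) v).
Proof. by rewrite ip_phcl; apply: tform_tens. Qed.

Definition tmap H H' (T : H -> H') : tensor X H -> tensor X H' :=
  tlift (fun x u => tens x (T u)).

Section TMap.
Variables (H H' : starRep A) (T : H -> H').
Variables (Tl : linear T) (Tc : forall a u, T (rep_op a u) = rep_op a (T u)).
Lemma tmap_bal : balanced (H := H) (fun (x : X) u => tens x (T u)).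
Proof.
split=> [|x a u]; last by rewrite Tc tensA.
split=> [x c u u'|u c x x']; last by rewrite tensDl tensZl.
by rewrite Tl tensDr tensZr.
Qed.
Lemma tmap_linear : linear (tmap T). Proof. exact: tlift_linear tmap_bal. Qed.
Lemma tmapE x u : tmap T (tens x u) = tens x (T u). Proof. exact: (tliftE tmap_bal). Qed.
End TMap.

Lemma tmapK H H' (T : H -> H') (S : H' -> H) :
  linear T -> (forall a u, T (rep_op a u) = rep_op a (T u)) ->
  linear S -> (forall a u, S (rep_op a u) = rep_op a (S u)) ->
  cancel T S -> cancel (tmap T) (tmap S).
Proof.
move=> Tl Tc Sl Sc TK t; elim/tens_ind: t => [s t hs ht|x u].
  by rewrite !(linD (tmap_linear _ _)) // hs ht.
by rewrite !tmapE // TK.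
Qed.

Lemma tmap_adjoint H H' (T : H -> H') (S : H' -> H) :
  linear T -> (forall a u, T (rep_op a u) = rep_op a (T u)) ->
  adjoint_pair (ip H) (ip H') T S ->
  adjoint_pair (rieffel_form H) (rieffel_form H') (tmap T) (tmap S).
Proof.
move=> Tl Tc adj s t /=.
have Sl := adjoint_linear adj; have Sc := adjoint_comm Tc adj.
elim/tens_ind: s => [s s' hs hs'|x u].
  by rewrite (linD (tmap_linear Tl Tc)) !tformDl hs hs'.
elim/tens_ind: t => [t t' ht ht'|y v].
  by rewrite (linD (tmap_linear Sl Sc)) !tformDr ht ht'.
by rewrite !tmapE // !tform_tens adj Sc.
Qed.

Section RieffelMap.
Variables (k : homKind) (H H' : starRep A) (T : intertwiner k H H').

Let Tl := itw_linear T.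
Let Tc := itw_comm T.

Lemma tmap_pre_kind : pre_kind k (rieffel_form H) (rieffel_form H') (tmap T).
Proof.
have := itw_kind T; rewrite /pre_kind; case: k T Tl Tc => S Sl Sc /=.
- move=> iso s t /=.
  elim/tens_ind: s => [s s' hs hs'|x u].
    by rewrite (linD (tmap_linear Sl Sc)) !tformDl hs hs'.
  elim/tens_ind: t => [t t' ht ht'|y v].
    by rewrite (linD (tmap_linear Sl Sc)) !tformDr ht ht'.
  by rewrite !tmapE // !tform_tens -Sc iso.
- case=> S' adj; exists (tmap S'); last exact: tmap_adjoint.
  exact: tmap_linear (adjoint_linear adj) (adjoint_comm Sc adj).
- case=> S' [adj SK KS]; have S'l := adjoint_linear adj; have S'c := adjoint_comm Sc adj.
  exists (tmap S'); first exact: tmap_linear.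
  by split; [exact: tmap_adjoint|exact: tmapK|exact: tmapK].
Qed.

Definition rieffel_map : rieffel_rep H -> rieffel_rep H' :=
  phmap (rieffel_form H) (rieffel_form H') (tmap T).

Lemma rieffel_mapE x u : rieffel_map (rtens x u) = rtens x (T u).
Proof.
rewrite /rieffel_map /rtens phmapE; first by rewrite (tmapE Tl Tc).
  exact: (tmap_linear Tl Tc).
exact: pre_kind_radical tmap_pre_kind.
Qed.

Lemma rieffel_map_linear : linear rieffel_map.
Proof.
exact: (phmap_linear (tmap_linear Tl Tc) (pre_kind_radical tmap_pre_kind)).
Qed.
End RieffelMap.

Lemma rieffel_ind H (P : rieffel_rep H -> Prop) :
  (forall s t, P s -> P t -> P (s + t)) -> (forall x u, P (rtens x u)) -> forall t, P t.
Proof.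
move=> PD P1 t; rewrite -[t]phreprK.
elim/tens_ind: (phrepr t) => [s s' hs hs'|x u]; last exact: P1.
by rewrite (linD (phcl_linear _)); apply: PD.
Qed.

Definition rieffel_itw k H H' (T : intertwiner k H H') :
  intertwiner k (rieffel_rep H) (rieffel_rep H').
refine (@Intertwiner k R B (rieffel_rep H) (rieffel_rep H') (rieffel_map T) _ _ _).
- exact: rieffel_map_linear.
- move=> b t; elim/rieffel_ind: t => [s t hs ht|x u].
    rewrite (linD ((rep_bilin _).1 _)) !(linD (rieffel_map_linear _)).
    by rewrite (linD ((rep_bilin _).1 _)) hs ht.
  by rewrite rieffel_mapE !rieffel_rep_opE rieffel_mapE.
- apply: has_kind_phmap; last exact: tmap_pre_kind.
  exact: tmap_linear (itw_linear T) (itw_comm T).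
Defined.

Definition rieffel_functor (k : homKind) : functor (repCat k A) (repCat k B).
refine (@Functor (repCat k A) (repCat k B) rieffel_rep (@rieffel_itw k) _ _).
- move=> H; apply: itw_ext => /= t; elim/rieffel_ind: t => [s t hs ht|x u].
    by rewrite (linD (rieffel_map_linear _)) hs ht.
  by rewrite rieffel_mapE.
- move=> H1 H2 H3 S T; apply: itw_ext => /= t; elim/rieffel_ind: t => [s t hs ht|x u].
    by rewrite !(linD (rieffel_map_linear _)) hs ht.
  by rewrite !rieffel_mapE.
Defined.
End Rieffel.

(* a C[[lambda]]-module viewed as a C-module *)
Definition rscal (R : realDomainType) (V : lmodType (cplx (series R))) : Type := V.

Section RestrictScalars.
Variables (R : realDomainType) (V : lmodType (cplx (series R))).
HB.instance Definition _ := GRing.Zmodule.on (rscal V).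

Definition rscale (c : cplx R) (v : rscal V) : rscal V := zconst c *: (v : V).
Lemma rscaleA c d v : rscale c (rscale d v) = rscale (c * d) v.
Proof. by rewrite /rscale scalerA zconstM. Qed.
Lemma rscale1 : left_id 1 rscale.
Proof. by move=> v; rewrite /rscale zconst1 scale1r. Qed.
Lemma rscaleDr : right_distributive rscale +%R.
Proof. by move=> c u v; rewrite /rscale -[u + v]/((u : V) + (v : V)) scalerDr. Qed.
Lemma rscaleDl v : {morph rscale^~ v : c d / c + d}.
Proof. by move=> c d; rewrite /rscale zconstD scalerDl. Qed.
HB.instance Definition _ := GRing.Zmodule_isLmodule.Build (cplx R) (rscal V)
  rscaleA rscale1 rscaleDr rscaleDl.
End RestrictScalars.

Lemma rscal_linear (R : realDomainType) (V W : lmodType (cplx (series R))) (f : V -> W) :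
  linear f -> linear (f : rscal V -> rscal W).
Proof. by move=> fl c u v; apply: (fl (zconst c) u v). Qed.

Section ClimSpace.
Variables (R : realDomainType) (H : preHilbert (series R)).

Definition clim_sform (u v : rscal H) : cplx R := zcoef (ip H u v) 0.

Lemma clim_sform_linear u : scalar (clim_sform u).
Proof.
move=> c v w; rewrite /clim_sform.
have -> : ip H u (c *: v + w) = zconst c * ip H u v + ip H u w.
  by rewrite -sform_linear.
by rewrite zcoefD zcoefcM.
Qed.
Lemma clim_sform_herm u v : clim_sform u v = conjc (clim_sform v u).
Proof. by rewrite /clim_sform sform_herm. Qed.
Lemma clim_sform_ge0 u : cnonneg (clim_sform u u).
Proof.
have [im0 re0] := sform_ge0 (ip H) u.
by split; [rewrite /= im0|apply: scoef_ge0].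
Qed.
Definition clim_form : semiInner (rscal H) :=
  SemiInner clim_sform_linear clim_sform_herm clim_sform_ge0.

Definition clim_space : preHilbert R := phquot clim_form.
Definition cl (u : H) : clim_space := phcl clim_form u.
End ClimSpace.

Section ClimRep.
Variables (R : realDomainType) (A : starAlgebra R) (D : deformation A).
Implicit Types H : starRep (deformed D).

Lemma clim_op_cl H (a b : deformed D) (u v : H) : cl_alg a = cl_alg b ->
  zcoef (ip H (rep_op a u) v) 0 = zcoef (ip H (rep_op b u) v) 0.
Proof.
move=> e; have [d de] : exists d : deformed D, a - b = lambda R *: d.
  by apply: (@ser_lambdaP R A); rewrite scoefB -[scoef a 0]/(cl_alg a) e subrr.
rewrite -[a](subrK b) de (rep_bilin H).2 sformDl sformZl zcoefD zcoefM0.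
by rewrite zcoef_conj lambda0 conjc0 mul0r add0r.
Qed.

Lemma clim_op_clr H (a b : deformed D) (u v : H) : cl_alg a = cl_alg b ->
  zcoef (ip H u (rep_op a v)) 0 = zcoef (ip H u (rep_op b v)) 0.
Proof.
move=> e; rewrite (sform_herm (ip H) u) (sform_herm (ip H) u (rep_op b v)).
by have := clim_op_cl v u e => /(congr1 (@conjc R)).
Qed.

Definition clim_op H (a : A) (u : rscal H) : rscal H := rep_op (const_alg D a) (u : H).

Lemma clim_preRep H : preRep (clim_form H) (@clim_op H).
Proof.
split.
- split=> [a|u c a b]; first exact: (rscal_linear ((rep_bilin H).1 _)).
  by rewrite /clim_op const_algD const_algZ (rep_bilin H).2.
- move=> a b u v; rewrite /= /clim_sform /clim_op -rep_mul; apply: clim_op_cl.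
  by rewrite cl_algM.
- move=> a u v; rewrite /= /clim_sform /clim_op rep_adj; apply: clim_op_clr.
  by rewrite cl_alg_star.
Qed.

Definition clim_rep H : starRep A := phrep (clim_preRep H).
Definition cl_vec H (u : H) : clim_rep H := cl u.

Lemma cl_vec_surj H (p : clim_rep H) : exists u : H, p = cl_vec u.
Proof. by exists (phrepr p); rewrite /cl_vec /cl phreprK. Qed.

Lemma clim_rep_opE H (a : deformed D) (u : H) :
  rep_op (cl_alg a) (cl_vec u) = cl_vec (rep_op a u).
Proof.
rewrite [LHS](phrep_opE (clim_preRep H)); apply: phcl_eq => w.
exact: clim_op_cl.
Qed.

Section ClimMap.
Variables (k : homKind) (H H' : starRep (deformed D)) (T : intertwiner k H H').

Lemma clim_pre_kind : pre_kind k (clim_form H) (clim_form H') (T : rscal H -> rscal H').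
Proof.
have := itw_kind T; rewrite /pre_kind; case: k T => S /=.
- by move=> iso u v; rewrite /= /clim_sform iso.
- case=> S' adj; exists S'; first exact: (rscal_linear (adjoint_linear adj)).
  by move=> u v; rewrite /= /clim_sform adj.
- case=> S' [adj SK KS]; exists S'; first exact: (rscal_linear (adjoint_linear adj)).
  by split=> // u v; rewrite /= /clim_sform adj.
Qed.

Definition clim_map : clim_rep H -> clim_rep H' :=
  phmap (clim_form H) (clim_form H') (T : rscal H -> rscal H').

Let Tl : linear (T : rscal H -> rscal H') := rscal_linear (itw_linear T).

Lemma clim_mapE u : clim_map (cl_vec u) = cl_vec (T u).
Proof. exact: (phmapE _ Tl (pre_kind_radical clim_pre_kind)). Qed.

Lemma clim_map_linear : linear clim_map.
Proof. exact: (phmap_linear Tl (pre_kind_radical clim_pre_kind)). Qed.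
End ClimMap.

Definition clim_itw k H H' (T : intertwiner k H H') : intertwiner k (clim_rep H) (clim_rep H').
refine (@Intertwiner k R A (clim_rep H) (clim_rep H') (clim_map T) _ _ _).
- exact: clim_map_linear.
- move=> a p; have [u ->] := cl_vec_surj p; rewrite -[a](const_algK D).
  by rewrite !(clim_rep_opE, clim_mapE) itw_comm.
- apply: has_kind_phmap; last exact: clim_pre_kind.
  exact: rscal_linear (itw_linear T).
Defined.

Definition clim_functor (k : homKind) : functor (repCat k (deformed D)) (repCat k A).
refine (@Functor (repCat k (deformed D)) (repCat k A) clim_rep (@clim_itw k) _ _).
- by move=> H; apply: itw_ext => /= p; have [u ->] := cl_vec_surj p; rewrite clim_mapE.
- move=> H1 H2 H3 S T; apply: itw_ext => /= p.
  by have [u ->] := cl_vec_surj p; rewrite !clim_mapE.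
Defined.
End ClimRep.

Section ClimBimodule.
Variables (R : realDomainType) (A B : starAlgebra R) (DA : deformation A) (DB : deformation B).
Variable (X : innerBimodule (deformed DB) (deformed DA)).

Definition clip (x y : X) : A := cl_alg (bm_ip x y).

Lemma clipDr x y z : clip x (y + z) = clip x y + clip x z.
Proof. by rewrite /clip (linD (bm_X1 x)). Qed.
Lemma clipZr x c y : clip x (c *: y) = zcoef c 0 *: clip x y.
Proof. by rewrite /clip (linZ (bm_X1 x)) cl_algZ. Qed.
Lemma clip_star x y : clip x y = sa_star (clip y x).
Proof. by rewrite /clip (bm_X2 x) cl_alg_star. Qed.
Lemma clipDl x y z : clip (y + z) x = clip y x + clip z x.
Proof. by rewrite clip_star clipDr (alinD (@sa_star_antilin _ A)) -!clip_star. Qed.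
Lemma clipZl x c y : clip (c *: y) x = conjc (zcoef c 0) *: clip y x.
Proof. by rewrite clip_star clipZr (alinZ (@sa_star_antilin _ A)) -!clip_star. Qed.

Definition clim_ker : submodule (rscal X).
refine (@Submodule _ _ (fun x : rscal X => forall y : X, clip x y = 0) _ _ _).
- by move=> y; rewrite -[0]/(0 : X) -(scale0r (0 : X)) clipZl conjc0 scale0r.
- by move=> x x' hx hx' y; rewrite -[x + x']/((x : X) + (x' : X)) clipDl hx hx' addr0.
- by move=> c x hx y; rewrite -[c *: x]/(zconst c *: (x : X)) clipZl hx scaler0.
Defined.

Definition clim_bm_sort := quotmod clim_ker.
HB.instance Definition _ := GRing.Lmodule.on clim_bm_sort.

Definition clx (x : X) : clim_bm_sort := qcl clim_ker x.

Lemma clx_eq (x y : X) : clx x = clx y <-> forall z, clip x z = clip y z.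
Proof.
have e z : clip (x - y) z = clip x z - clip y z.
  rewrite clipDl -scaleN1r clipZl; congr (_ + _).
  by rewrite -[RHS]scaleN1r; congr (_ *: _); apply/cplxP; rewrite //= !oppr0.
split=> [/qcl_eq h z|h]; last by apply/qcl_eq => z; apply/eqP; rewrite [clip _ _]e h subrr.
by apply/eqP; rewrite -subr_eq0 -e; apply/eqP/h.
Qed.

Lemma clim_bm_l_cl (b b' : deformed DB) (x y : X) : cl_alg b = cl_alg b' ->
  clip (bm_l b x) y = clip (bm_l b' x) y.
Proof.
move=> e; have [d de] : exists d : deformed DB, b - b' = lambda R *: d.
  by apply: (@ser_lambdaP R B); rewrite scoefB -[scoef b 0]/(cl_alg b) e subrr.
rewrite -[b](subrK b') de (bm_l_bilin X).2 clipDl clipZl.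
by rewrite lambda0 conjc0 scale0r add0r.
Qed.

Lemma clim_bm_r_cl (a a' : deformed DA) (x y : X) : cl_alg a = cl_alg a' ->
  clip (bm_r x a) y = clip (bm_r x a') y.
Proof.
move=> e; rewrite clip_star [RHS]clip_star; congr sa_star.
by rewrite /clip !bm_X3 !cl_algM e.
Qed.

Lemma clip_l b x y : clip (bm_l b x) y = clip x (bm_l (sa_star b) y).
Proof. by rewrite /clip bm_X5 sa_starK. Qed.

Lemma clip_r a x y : clip x (bm_r y a) = sa_mul (clip x y) (cl_alg a).
Proof. by rewrite /clip bm_X3 cl_algM. Qed.

Definition clim_bm_l (b : B) (p : clim_bm_sort) : clim_bm_sort :=
  clx (bm_l (const_alg DB b) (qrepr p)).
Definition clim_bm_r (p : clim_bm_sort) (a : A) : clim_bm_sort :=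
  clx (bm_r (qrepr p) (const_alg DA a)).
Definition clim_bm_ip (p q : clim_bm_sort) : A := clip (qrepr p) (qrepr q).

Lemma clip_repr (x y : X) : clip (qrepr (clx x)) y = clip x y.
Proof. by have /clx_eq -> : clx (qrepr (clx x)) = clx x by exact: qreprK. Qed.

Lemma clip_repr_r (x y : X) : clip y (qrepr (clx x)) = clip y x.
Proof. by rewrite clip_star clip_repr -clip_star. Qed.

Lemma clim_bm_lE (b : deformed DB) x : clim_bm_l (cl_alg b) (clx x) = clx (bm_l b x).
Proof.
apply/clx_eq => z; rewrite clip_l clip_repr -clip_l; exact: clim_bm_l_cl.
Qed.
Lemma clim_bm_rE (a : deformed DA) x : clim_bm_r (clx x) (cl_alg a) = clx (bm_r x a).
Proof.
apply/clx_eq => z; rewrite clip_star [RHS]clip_star !clip_r.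
by rewrite clip_repr_r.
Qed.
Lemma clim_bm_ipE x y : clim_bm_ip (clx x) (clx y) = clip x y.
Proof. by rewrite /clim_bm_ip clip_repr clip_star clip_repr -clip_star. Qed.

Lemma clxK (p : clim_bm_sort) : clx (qrepr p) = p. Proof. exact: qreprK. Qed.

Lemma clxD x y : clx (x + y) = clx x + clx y.
Proof. exact: (linearD (qcl clim_ker)). Qed.
Lemma clxZ c x : clx (c *: x) = zcoef c 0 *: clx x.
Proof.
rewrite -[RHS]/(zcoef c 0 *: qcl clim_ker x) -qclZ; apply/clx_eq => z.
by rewrite clipZl -[zcoef c 0 *: _]/(zconst (zcoef c 0) *: (x : X)) clipZl zcoef_const0.
Qed.

Lemma zcoef_surj (c : cplx R) : exists d : cplx (series R), c = zcoef d 0.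
Proof. by exists (zconst c); rewrite zcoef_const0. Qed.
Lemma cl_algB_surj (b : B) : exists d : deformed DB, b = cl_alg d.
Proof. by exists (const_alg DB b). Qed.
Lemma cl_algA_surj (a : A) : exists d : deformed DA, a = cl_alg d.
Proof. by exists (const_alg DA a). Qed.
Lemma clx_surj (p : clim_bm_sort) : exists x : X, p = clx x.
Proof. by exists (qrepr p); rewrite clxK. Qed.

Definition clim_bimodule : innerBimodule B A.
refine (@InnerBimodule R B A clim_bm_sort clim_bm_l clim_bm_r _ _ _ _ _ clim_bm_ip _ _ _ _).
- split=> [b c p q|p c b b'].
    have [d ->] := zcoef_surj c; have [x ->] := clx_surj p; have [y ->] := clx_surj q.
    have [e ->] := cl_algB_surj b.
    by rewrite -clxZ -clxD !clim_bm_lE (bm_l_bilin X).1 clxD clxZ.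
  have [d ->] := zcoef_surj c; have [x ->] := clx_surj p.
  have [e ->] := cl_algB_surj b; have [e' ->] := cl_algB_surj b'.
  by rewrite -cl_algZ -cl_algD !clim_bm_lE (bm_l_bilin X).2 clxD clxZ.
- split=> [p c a a'|a c p q].
    have [d ->] := zcoef_surj c; have [x ->] := clx_surj p.
    have [e ->] := cl_algA_surj a; have [e' ->] := cl_algA_surj a'.
    by rewrite -cl_algZ -cl_algD !clim_bm_rE (bm_r_bilin X).1 clxD clxZ.
  have [d ->] := zcoef_surj c; have [x ->] := clx_surj p; have [y ->] := clx_surj q.
  have [e ->] := cl_algA_surj a.
  by rewrite -clxZ -clxD !clim_bm_rE (bm_r_bilin X).2 clxD clxZ.
- move=> b b' p; have [x ->] := clx_surj p.
  have [e ->] := cl_algB_surj b; have [e' ->] := cl_algB_surj b'.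
  by rewrite -cl_algM !clim_bm_lE bm_lM.
- move=> p a a'; have [x ->] := clx_surj p.
  have [e ->] := cl_algA_surj a; have [e' ->] := cl_algA_surj a'.
  by rewrite -cl_algM !clim_bm_rE bm_rM.
- move=> b p a; have [x ->] := clx_surj p.
  have [d ->] := cl_algB_surj b; have [e ->] := cl_algA_surj a.
  by rewrite !(clim_bm_lE, clim_bm_rE) bm_lr.
- move=> p c q r; have [d ->] := zcoef_surj c; have [x ->] := clx_surj p.
  have [y ->] := clx_surj q; have [z ->] := clx_surj r.
  by rewrite -clxZ -clxD !clim_bm_ipE clipDr clipZr.
- move=> p q; have [x ->] := clx_surj p; have [y ->] := clx_surj q.
  by rewrite !clim_bm_ipE clip_star.
- move=> p q a; have [x ->] := clx_surj p; have [y ->] := clx_surj q.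
  have [e ->] := cl_algA_surj a.
  by rewrite clim_bm_rE !clim_bm_ipE clip_r.
- move=> p b q; have [x ->] := clx_surj p; have [y ->] := clx_surj q.
  have [d ->] := cl_algB_surj b.
  by rewrite -cl_alg_star !clim_bm_lE !clim_bm_ipE clip_l sa_starK.
Defined.

Definition cl_bm (x : X) : clim_bimodule := clx x.

Lemma cl_bm_l (b : deformed DB) x : bm_l (cl_alg b) (cl_bm x) = cl_bm (bm_l b x).
Proof. exact: clim_bm_lE. Qed.
Lemma cl_bm_r (a : deformed DA) x : bm_r (cl_bm x) (cl_alg a) = cl_bm (bm_r x a).
Proof. exact: clim_bm_rE. Qed.
Lemma cl_bm_ip (x y : X) : bm_ip (cl_bm x) (cl_bm y) = cl_alg (bm_ip x y).
Proof. exact: clim_bm_ipE. Qed.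
End ClimBimodule.

(* Main.v *)
(* Both [clim_rep (rieffel_rep XP H)] and [rieffel_rep XPcl (clim_rep H)] are
   additively generated by vectors indexed by the pairs (x, u) (the scalars are
   absorbed into x), and the two Gram matrices coincide, both being the zeroth
   order of <u, pi(<x,y>) v>.  As the inner products are non-degenerate, matching
   the generators defines the unitary U. *)

Require Import Defs.
From mathcomp Require Import all_boot all_order all_algebra.
From mathcomp Require Import boolp.

Set Implicit Arguments.
Unset Strict Implicit.
Unset Printing Implicit Defensive.

Import GRing.Theory Num.Theory.
Local Open Scope ring_scope.

(** An induction principle without scalars: it amounts to every vector being a finite non-empty sum
    of values of [g], so additive identities can be checked on generators alone. *)
Definition additively_generates (V : zmodType) (I : Type) (g : I -> V) : Prop :=
  forall P : V -> Prop, (forall s t, P s -> P t -> P (s + t)) ->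
    (forall i, P (g i)) -> forall t, P t.

Section GramMatrix.
Variables (R : realDomainType) (I : Type).

(** Additivity in the first argument spreads the equality from the generators to all test vectors;
    definiteness then concludes. *)
Lemma ip_generates_inj (H : preHilbert R) (g : I -> H) (u v : H) :
  additively_generates g -> (forall i, ip H (g i) u = ip H (g i) v) -> u = v.
Proof.
move=> gen e; apply: ip_inj => w.
by apply: (gen (fun w => ip H w u = ip H w v)) => // s t hs ht; rewrite !sformDl hs ht.
Qed.

(** Mapping a sum of generators termwise would require independence of the decomposition.
    Prescribing the products of [T p] with the [g' i] avoids this: decompositions only show that
    such a vector exists, and choice picks one. *)
Lemma gram_transfer (H H' : preHilbert R) (g : I -> H) (g' : I -> H') :
  additively_generates g ->
  (forall i j, ip H' (g' i) (g' j) = ip H (g i) (g j)) ->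
  exists T : H -> H', forall i p, ip H' (g' i) (T p) = ip H (g i) p.
Proof.
move=> gen gram.
have ex p : exists q, forall i, ip H' (g' i) q = ip H (g i) p.
  move: p; apply: gen => [s t [s' hs] [t' ht]|j]; last by exists (g' j).
  by exists (s' + t') => i; rewrite !sformDr hs ht.
by exists (fun p => projT1 (cid (ex p))) => i p; apply: (projT2 (cid (ex p))).
Qed.

(** Swapping the two families gives a map back. Since products with generators determine a vector,
    [T] is linear and the two maps are mutually inverse. *)
Lemma gram_unitary (H H' : preHilbert R) (g : I -> H) (g' : I -> H') :
  additively_generates g -> additively_generates g' ->
  (forall i j, ip H' (g' i) (g' j) = ip H (g i) (g j)) ->
  exists T : H -> H', [/\ linear T, unitary (ip H) (ip H') T & forall i, T (g i) = g' i].
Proof.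
move=> gen gen' gram.
have [T hT] := gram_transfer gen gram.
have [S hS] := gram_transfer gen' (fun i j => esym (gram i j)).
have Tg i : T (g i) = g' i by apply: (ip_generates_inj gen') => j; rewrite hT gram.
have Tl : linear T.
  by move=> c u v; apply: (ip_generates_inj gen') => j;
    rewrite !(sformDr, sformZr, hT).
exists T; split=> //; exists S; split=> [u w|u|w].
(* [hS] tests against generators only, hence the induction on [u]. *)
- apply: (gen (fun u => ip H' (T u) w = ip H u (S w))) => [s t hs ht|i].
    by rewrite (linD Tl) !sformDl hs ht.
  by rewrite Tg hS.
- by apply: (ip_generates_inj gen) => i; rewrite hS hT.
- by apply: (ip_generates_inj gen') => i; rewrite hT hS.
Qed.
End GramMatrix.

(** This lets one and the same unitary serve for every choice of morphisms. *)
Lemma unitary_has_kind (k : homKind) (R : realDomainType) (H H' : preHilbert R) (T : H -> H') :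
  unitary (ip H) (ip H') T -> has_kind k T.
Proof.
case=> S [adj TK SK]; case: k => /=; last by exists S.
- by move=> u v; rewrite adj TK.
- by exists S.
Qed.

(** The inverse of a unitary is its adjoint, and adjoints inherit linearity and the intertwining
    property, so the inverse is a morphism as well. *)
Lemma unitary_natIso (k : homKind) (R : realDomainType) (A : starAlgebra R) (C : category)
    (F G : functor C (repCat k A)) (T : forall a, (F a : starRep A) -> (G a : starRep A)) :
  (forall a, linear (T a)) ->
  (forall a b p, T a (rep_op b p) = rep_op b (T a p)) ->
  (forall a, unitary (ip (F a : starRep A)) (ip (G a : starRep A)) (T a)) ->
  (forall a b (f : Defs.hom a b) p, T b (itw (fmap F f) p) = itw (fmap G f) (T a p)) ->
  exists eta : natIso F G, forall a p, itw (nat_fwd eta a) p = T a p.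
Proof.
move=> Tl Tc Tu Tn.
pose S a := projT1 (cid (Tu a)); have hS a := projT2 (cid (Tu a)).
have adj a : adjoint_pair (ip (F a : starRep A)) (ip (G a : starRep A)) (T a) (S a).
  by case: (hS a).
have TK a : cancel (T a) (S a) by case: (hS a).
have SK a : cancel (S a) (T a) by case: (hS a).
have Su a : unitary (ip (G a : starRep A)) (ip (F a : starRep A)) (S a).
  by exists (T a); split=> //; apply: adjoint_sym.
pose fwd a : @Defs.hom (repCat k A) (F a) (G a) :=
  Intertwiner (Tl a) (Tc a) (unitary_has_kind k (Tu a)).
pose bwd a : @Defs.hom (repCat k A) (G a) (F a) :=
  Intertwiner (adjoint_linear (adj a)) (adjoint_comm (Tc a) (adj a))
    (unitary_has_kind k (Su a)).
have fwdK a : comp_hom (bwd a) (fwd a) = id_hom (F a) by apply: itw_ext => p; apply: TK.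
have bwdK a : comp_hom (fwd a) (bwd a) = id_hom (G a) by apply: itw_ext => p; apply: SK.
have comm a b (f : Defs.hom a b) :
    comp_hom (fwd b) (fmap F f) = comp_hom (fmap G f) (fwd a).
  by apply: itw_ext => p; apply: Tn.
by exists (NatIso fwdK bwdK comm).
Qed.

Section ClassicalLimitRieffel.
Variables (R : realDomainType) (A B : starAlgebra R) (DA : deformation A) (DB : deformation B).
Variable (X : innerBimodule (deformed DB) (deformed DA)).
Variables (XP : axiomP X) (XPcl : axiomP (clim_bimodule X)).
Implicit Types H : starRep (deformed DA).

(** Elementary tensors generate the tensor product additively, and this survives both quotients. *)
Lemma clim_rieffel_ind H (P : clim_rep (rieffel_rep XP H) -> Prop) :
  (forall s t, P s -> P t -> P (s + t)) ->
  (forall (x : X) (u : H), P (cl_vec (rtens XP x u))) -> forall p, P p.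
Proof.
move=> PD Pg p; have [t ->] := cl_vec_surj p.
elim/rieffel_ind: t => [s t hs ht|x u]; last exact: Pg.
by rewrite /cl_vec /cl (linD (phcl_linear _)); apply: PD.
Qed.

(** Both factors of an elementary tensor are classical limits, because the two class maps are
    onto. *)
Lemma rieffel_clim_ind H (P : rieffel_rep XPcl (clim_rep H) -> Prop) :
  (forall s t, P s -> P t -> P (s + t)) ->
  (forall (x : X) (u : H), P (rtens XPcl (cl_bm x) (cl_vec u))) -> forall q, P q.
Proof.
move=> PD Pg; elim/rieffel_ind => // y v.
by have [x ->] := clx_surj y; have [u ->] := cl_vec_surj v.
Qed.

(** Class maps commute with the algebra-valued inner product and with the action, so the classical
    limit can be taken last on either side. *)
Lemma clim_rieffel_gram H (x y : X) (u v : H) :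
  ip (rieffel_rep XPcl (clim_rep H)) (rtens XPcl (cl_bm x) (cl_vec u))
     (rtens XPcl (cl_bm y) (cl_vec v)) =
  ip (clim_rep (rieffel_rep XP H)) (cl_vec (rtens XP x u)) (cl_vec (rtens XP y v)).
Proof.
rewrite ip_rtens cl_bm_ip clim_rep_opE.
rewrite [LHS]ip_phcl [RHS]ip_phcl /= /clim_sform.
by rewrite -(ip_rtens XP).
Qed.

Lemma clim_rieffel_unitary H :
  exists U : clim_rep (rieffel_rep XP H) -> rieffel_rep XPcl (clim_rep H),
    [/\ linear U,
        unitary (ip (clim_rep (rieffel_rep XP H))) (ip (rieffel_rep XPcl (clim_rep H))) U
      & forall (x : X) (u : H),
          U (cl_vec (rtens XP x u)) = rtens XPcl (cl_bm x) (cl_vec u)].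
Proof.
pose g (xu : X * H) := cl_vec (rtens XP xu.1 xu.2).
pose g' (xu : X * H) := rtens XPcl (cl_bm xu.1) (cl_vec xu.2).
have gen : additively_generates g.
  by move=> P PD Pg; apply: clim_rieffel_ind => // x u; apply: (Pg (x, u)).
have gen' : additively_generates g'.
  by move=> P PD Pg; apply: rieffel_clim_ind => // x u; apply: (Pg (x, u)).
have [U [Ul Uu Ug]] := gram_unitary gen gen' (fun i j => clim_rieffel_gram i.1 j.1 i.2 j.2).
by exists U; split=> // x u; apply: (Ug (x, u)).
Qed.
End ClassicalLimitRieffel.

Theorem proposition9p5 (R : realDomainType) (A B : starAlgebra R)
    (DA : deformation A) (DB : deformation B)
    (X : innerBimodule (deformed DB) (deformed DA))
    (X4 : axiomX4 X) (XP : axiomP X)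
    (X4cl : axiomX4 (clim_bimodule X)) (XPcl : axiomP (clim_bimodule X)) :
  exists U : forall H : starRep (deformed DA),
      clim_rep (rieffel_rep XP H) -> rieffel_rep XPcl (clim_rep H),
    (forall H : starRep (deformed DA),
      [/\ linear (U H),
          forall (x : X) (u : H), U H (cl_vec (rtens XP x u)) = rtens XPcl (cl_bm x) (cl_vec u),
          forall V : clim_rep (rieffel_rep XP H) -> rieffel_rep XPcl (clim_rep H),
            linear V ->
            (forall (x : X) (u : H), V (cl_vec (rtens XP x u)) = rtens XPcl (cl_bm x) (cl_vec u)) ->
            forall p, V p = U H p,
          unitary (ip (clim_rep (rieffel_rep XP H))) (ip (rieffel_rep XPcl (clim_rep H))) (U H)
        & forall (b : B) p, U H (rep_op b p) = rep_op b (U H p)]) /\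
    (forall k : homKind,
      exists eta : natIso (comp_functor (clim_functor DB k) (rieffel_functor XP k))
                          (comp_functor (rieffel_functor XPcl k) (clim_functor DA k)),
        forall (H : starRep (deformed DA)) p, itw (nat_fwd eta H) p = U H p).
Proof.
pose U H := projT1 (cid (clim_rieffel_unitary XP XPcl H)).
have Ul H : linear (U H) by case: (projT2 (cid (clim_rieffel_unitary XP XPcl H))).
have Uu H : unitary (ip (clim_rep (rieffel_rep XP H)))
    (ip (rieffel_rep XPcl (clim_rep H))) (U H).
  by case: (projT2 (cid (clim_rieffel_unitary XP XPcl H))).
have UE (H : starRep (deformed DA)) (x : X) (u : H) :
    U H (cl_vec (rtens XP x u)) = rtens XPcl (cl_bm x) (cl_vec u).
  by have [_ _] := projT2 (cid (clim_rieffel_unitary XP XPcl H)); apply.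
have Uc H (b : B) p : U H (rep_op b p) = rep_op b (U H p).
  elim/clim_rieffel_ind: p => [s t hs ht|x u].
    by rewrite (linD ((rep_bilin _).1 _)) !(linD (Ul H)) (linD ((rep_bilin _).1 _)) hs ht.
  (* [b] is the classical limit of its constant series, which acts on [x] inside [X] before any
     class is taken. *)
  rewrite -[b](const_algK DB) clim_rep_opE rieffel_rep_opE !UE.
  by rewrite rieffel_rep_opE cl_bm_l.
exists U; split=> [H|k].
  split=> // V Vl VE p.
  (* Uniqueness: additivity reduces the comparison to generators. *)
  elim/clim_rieffel_ind: p => [s t hs ht|x u].
    by rewrite (linD Vl) (linD (Ul H)) hs ht.
  by rewrite VE UE.
apply: (@unitary_natIso k R B _ (comp_functor (clim_functor DB k) (rieffel_functor XP k))
  (comp_functor (rieffel_functor XPcl k) (clim_functor DA k)) U) => //= H H' T p.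
(* Naturality: on a generator both composites keep [x] and replace [u] by [T u]. *)
elim/clim_rieffel_ind: p => [s t hs ht|x u].
  by rewrite (linD (clim_map_linear _)) !(linD (Ul _)) (linD (rieffel_map_linear _)) hs ht.
rewrite clim_mapE /= rieffel_mapE !UE rieffel_mapE /=.
by rewrite clim_mapE.
Qed.
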